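(* Let $1\le p,p_1,\dots,p_m<\infty$ with $\frac1p=\frac1{p_1}+\cdots+\frac1{p_m}$, let $X_1,\dots,X_m,Y$ be Banach spaces and let $\Phi_j:\widehat X_j\to C(B_{X_j^*})$, $j=1,\dots,m$, be bounded homogeneous maps. An $m$-linear operator $T\in\mathcal L(X_1,\dots,X_m;Y)$ is $(\Phi_1,\dots,\Phi_m)$-abstract $(p_1,\dots,p_m)$-summing if and only if there are Banach spaces $G_j$ and $\Phi_j$-abstract $p_j$-summing linear operators $u_j:X_j\to G_j$, $j=1,\dots,m$, such that $T$ factors through $G_1\times\cdots\times G_m$ as $T=\widehat T\circ(u_1,\dots,u_m)$, where $\widehat T\in\mathcal L(G_1,\dots,G_m;Y)$.
   Context: $\mathcal L(X_1,\dots,X_m;Y)$ is the space of continuous $m$-linear mappings $X_1\times\cdots\times X_m\to Y$. $B_{X_j^*}$ is the closed unit ball of $X_j^*$ with the weak* topology (compact Hausdorff), $C(B_{X_j^*})$ the space of continuous functions on it with the supremum norm. For $x\in X_j$, $\langle x,\cdot\rangle\in C(B_{X_j^*})$ is $x^*\mapsto\langle x,x^*\rangle$, and $\widehat X_j=\{\langle x,\cdot\rangle:x\in X_j\}\subset C(B_{X_j^*})$. A (not necessarily linear) map $\Phi$ is homogeneous if $\Phi(\lambda v)=\lambda\Phi(v)$ for all real $\lambda>0$ and all $v$, and bounded if there is a constant $K$ with $\|\Phi(v)\|\le K\|v\|$ for all $v$. $T$ is $(\Phi_1,\dots,\Phi_m)$-abstract $(p_1,\dots,p_m)$-summing if there is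 $C>0$ such that for all $n\in\mathbb N$ and $x_1^j,\dots,x_n^j\in X_j$ ($1\le j\le m$), $$\Big(\sum_{i=1}^n\|T(x_i^1,\dots,x_i^m)\|^p\Big)^{1/p}\le C\prod_{j=1}^m\Big\|\Big(\sum_{i=1}^n|\Phi_j(\langle x_i^j,\cdot\rangle)|^{p_j}\Big)^{1/p_j}\Big\|_{C(B_{X_j^*})}.$$ A linear operator $u:X_j\to G$ is $\Phi_j$-abstract $p_j$-summing if there is $C>0$ such that for all $n$ and $x_1,\dots,x_n\in X_j$, $$\Big(\sum_{i=1}^n\|u(x_i)\|^{p_j}\Big)^{1/p_j}\le C\Big\|\Big(\sum_{i=1}^n|\Phi_j(\langle x_i,\cdot\rangle)|^{p_j}\Big)^{1/p_j}\Big\|_{C(B_{X_j^*})}.$$ $(u_1,\dots,u_m)$ denotes the map $(x^1,\dots,x^m)\mapsto(u_1(x^1),\dots,u_m(x^m))$. *)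

(* Defs.v *)
From HB Require Import structures.
From mathcomp Require Import all_boot all_order all_algebra.
From mathcomp Require Import complex.
From mathcomp Require Import all_classical all_reals all_analysis.
Import Order.TTheory GRing.Theory Num.Theory.
Import numFieldNormedType.Exports.

Set Implicit Arguments.
Unset Strict Implicit.
Unset Printing Implicit Defensive.

Local Open Scope classical_set_scope.
Local Open Scope ring_scope.

(* The scalar field of the Banach spaces is either R or C = R[i].  Norms in
   MathComp-Analysis take their values in the scalar field, so the real number
   underlying an absolute value or a norm is recovered by [modulus]. *)
Variant scalar_field (R : realType) : numFieldType -> Type :=
| ScalarReal : scalar_field R R
| ScalarComplex : scalar_field R (complex R).

Definition modulus (R : realType) (K : numFieldType) (s : scalar_field R K) :
    K -> R :=
  match s in scalar_field _ K return K -> R with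
  | ScalarReal => fun a => `|a|
  | ScalarComplex => fun a => complex.Re `|a|
  end.

Definition rnorm (R : realType) (K : numFieldType) (s : scalar_field R K)
    (V : normedModType K) (v : V) : R :=
  modulus s `|v|.

Definition supnorm (R : realType) (T : Type) (g : T -> R) : R :=
  sup (range (fun t => `|g t|)).

Section weak_star_ball.
Context (R : realType) (K : numFieldType) (s : scalar_field R K).

Definition dual_norm (X : normedModType K) (f : X -> K) : R :=
  sup [set modulus s (f x) | x in [set x : X | rnorm s x <= 1]].

(* As a subspace of the product topology (the topology of pointwise
   convergence), the closed unit ball of the dual carries the weak* topology. *)
Definition dual_ball (X : normedModType K) : set {ptws X -> K} :=
  [set f : X -> K | [/\ scalar f, continuous f & dual_norm f <= 1]].
Arguments dual_ball : clear implicits.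

Definition CBall (X : normedModType K) : Type :=
  continuousType (dual_ball X) K.
Arguments CBall : clear implicits.

Definition CBall_norm (X : normedModType K) (g : CBall X) : R :=
  supnorm (fun f : dual_ball X => modulus s (g f)).

Lemma eval_continuous (X : normedModType K) (x : X) :
  continuous (fun f : dual_ball X => set_val f x : K).
Proof.
move=> f; apply: (@continuous_comp _ {ptws X -> K} _ set_val (fun h => h x)).
  exact: initial_continuous.
exact: proj_continuous.
Qed.

Definition ev (X : normedModType K) (x : X) : CBall X :=
  mkcts (@eval_continuous X x).

Definition hat (X : normedModType K) : set (CBall X) := range (@ev X).
Arguments hat : clear implicits.

Definition to_hat (X : normedModType K) (x : X) : hat X :=
  SigSub (mem_set (imageT (@ev X) x)).

(* In the order of the scalar field K, [0 < a] says that [a] is real and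
   positive.  As [hat X] is a linear subspace, every multiple of [v] by a scalar
   is (extensionally) some [w] in [hat X]. *)
Definition homogeneous (X : normedModType K) (Phi : hat X -> CBall X) : Prop :=
  forall (a : K) (v w : hat X), 0 < a ->
    (forall f, set_val w f = a * set_val v f) ->
    forall f, Phi w f = a * Phi v f.

Definition bounded_map (X : normedModType K) (Phi : hat X -> CBall X) : Prop :=
  exists k : R, forall v : hat X,
    CBall_norm (Phi v) <= k * CBall_norm (set_val v).

(* The norm in C(B_{X^* }) of (\sum_i |Phi <x_i, .>|^q)^(1/q). *)
Definition abstract_norm (X : normedModType K) (Phi : hat X -> CBall X) (q : R)
    (n : nat) (x : 'I_n -> X) : R :=
  supnorm (fun f : dual_ball X =>
    (\sum_(i < n) modulus s (Phi (to_hat (x i)) f) `^ q) `^ q^-1).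

Definition abstract_summing (X G : normedModType K) (Phi : hat X -> CBall X)
    (q : R) (u : X -> G) : Prop :=
  exists2 C : R, 0 < C & forall (n : nat) (x : 'I_n -> X),
    (\sum_(i < n) rnorm s (u (x i)) `^ q) `^ q^-1 <= C * abstract_norm Phi q x.

Definition multi_abstract_summing (m : nat) (X : 'I_m -> normedModType K)
    (Y : normedModType K) (Phi : forall j, hat (X j) -> CBall (X j))
    (p : R) (q : 'I_m -> R) (T : (forall j, X j) -> Y) : Prop :=
  exists2 C : R, 0 < C & forall (n : nat) (x : forall j, 'I_n -> X j),
    (\sum_(i < n) rnorm s (T (fun j => x j i)) `^ p) `^ p^-1
      <= C * \prod_(j < m) abstract_norm (Phi j) (q j) (x j).

End weak_star_ball.

Arguments dual_ball {R K} s X.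
Arguments CBall {R K} s X.
Arguments hat {R K} s X.

Definition multilinear (K : numFieldType) (m : nat) (X : 'I_m -> lmodType K)
    (Y : lmodType K) (T : (forall j, X j) -> Y) : Prop :=
  forall (x : forall j, X j) (j : 'I_m),
    linear (fun v : X j => T (eqtype.dfwith x v)).

Definition continuous_multilinear (K : numFieldType) (m : nat)
    (X : 'I_m -> normedModType K) (Y : normedModType K)
    (T : (forall j, X j) -> Y) : Prop :=
  multilinear T /\ continuous (T : prod_topology X -> Y).

(* Main.v *)
(** Pietsch domination turns the summing inequality into a bound
    [|T x| <= C * \prod_j d_j(x_j)], where [d_j(x)^(q_j)] is the value at
    [|Phi_j <x, .>|^(q_j)] of one positive functional on the bounded functions on
    the product of the dual balls.  No measure is needed: the functional comes
    from the Hahn-Banach theorem, obtained here from Zorn's lemma and the fact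
    that a minimal sublinear functional is linear.

    Since [Phi_j] is not linear, [d_j] is not a seminorm, so [x |-> Phi_j <x, .>]
    cannot serve as [u_j].  Instead [u_j x] is the evaluation [S |-> S x] on the
    set of all linear [S : X_j -> Y] with [|S| <= d_j], under the supremum norm,
    and [G_j] is the closure of the range of [u_j].  Then [|u_j x| <= d_j x], while
    fixing all arguments of [T] but the j-th gives a multiple of such an [S], so
    that each [d_j(x_j)] in the bound on [T] may be replaced by [|u_j x_j|]; hence
    [T] factors through the [u_j] and extends by continuity. *)
Require Import Defs.
From HB Require Import structures.
From mathcomp Require Import all_boot all_order all_algebra.
From mathcomp Require Import complex.
From mathcomp Require Import all_classical all_reals all_analysis.
From mathcomp Require Import ring lra.
Import Order.TTheory GRing.Theory Num.Theory.
Import numFieldNormedType.Exports.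

Set Implicit Arguments.
Unset Strict Implicit.
Unset Printing Implicit Defensive.

Local Open Scope classical_set_scope.
Local Open Scope ring_scope.

(** * Scalars *)

(** Embeds the reals in [K]. It preserves and reflects the order and sends [modulus s a] back to the
    norm of [a], so that facts about [K]-valued norms become real inequalities. *)
Definition scalar_of (R : realType) (K : numFieldType) (s : scalar_field R K) :
    R -> K :=
  match s in scalar_field _ K return R -> K with
  | ScalarReal => id
  | ScalarComplex => fun a => real_complex R a
  end.

Section Scalars.
Context (R : realType) (K : numFieldType) (s : scalar_field R K).
Local Notation ofR := (scalar_of s).
Local Notation md := (modulus s).

Lemma scalar_ofD a b : ofR (a + b) = ofR a + ofR b.
Proof. by case: s => //=; rewrite rmorphD. Qed.

Lemma scalar_ofM a b : ofR (a * b) = ofR a * ofR b.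
Proof. by case: s => //=; rewrite rmorphM. Qed.

Lemma scalar_of0 : ofR 0 = 0.
Proof. by case: s. Qed.

Lemma scalar_of1 : ofR 1 = 1.
Proof. by case: s. Qed.

Lemma ler_scalar_of a b : (ofR a <= ofR b) = (a <= b).
Proof. by case: s => //=; rewrite lecR. Qed.

Lemma ltr_scalar_of a b : (ofR a < ofR b) = (a < b).
Proof. by case: s => //=; rewrite ltcR. Qed.

Lemma scalar_of_modulus a : ofR (md a) = `|a|.
Proof. by case: s a => //= a; rewrite RRe_real // normr_real. Qed.

Lemma scalar_of_inj : injective ofR.
Proof.
by move=> a b ab; apply/eqP; rewrite eq_le -!ler_scalar_of ab lexx.
Qed.

Lemma modulus_ge0 a : 0 <= md a.
Proof. by rewrite -ler_scalar_of scalar_of0 scalar_of_modulus. Qed.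

Lemma modulusM a b : md (a * b) = md a * md b.
Proof. by apply: scalar_of_inj; rewrite scalar_ofM !scalar_of_modulus normrM. Qed.

Lemma scalar_ofN a : ofR (- a) = - ofR a.
Proof. by apply/eqP; rewrite -addr_eq0 -scalar_ofD addNr scalar_of0. Qed.

Lemma modulus_scalar_of r : md (ofR r) = `|r|.
Proof.
apply: scalar_of_inj; rewrite scalar_of_modulus.
have [r0|/ltW r0] := leP 0 r; last rewrite -[in LHS](opprK r) scalar_ofN normrN.
  by rewrite !ger0_norm// -scalar_of0 ler_scalar_of.
by rewrite ger0_norm ?ler0_norm// -scalar_of0 ler_scalar_of oppr_ge0.
Qed.

Lemma scalar_of_gt0 r : (0 < ofR r) = (0 < r).
Proof. by rewrite -{1}scalar_of0 ltr_scalar_of. Qed.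

Lemma gt0_scalarP e : 0 < e -> exists2 r : R, 0 < r & e = ofR r.
Proof.
move=> e0; exists (md e); last by rewrite scalar_of_modulus gtr0_norm.
by rewrite -scalar_of_gt0 scalar_of_modulus gtr0_norm.
Qed.

Lemma modulusD a b : md (a + b) <= md a + md b.
Proof. by rewrite -ler_scalar_of scalar_ofD !scalar_of_modulus ler_normD. Qed.

Lemma modulusN a : md (- a) = md a.
Proof. by apply: scalar_of_inj; rewrite !scalar_of_modulus normrN. Qed.

Lemma modulus_eq0 a : md a = 0 -> a = 0.
Proof.
by move=> a0; apply/normr0_eq0; rewrite -scalar_of_modulus a0 scalar_of0.
Qed.

Lemma modulus0 : md 0 = 0.
Proof. by rewrite -scalar_of0 modulus_scalar_of normr0. Qed.

Lemma modulus1 : md 1 = 1.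
Proof. by rewrite -scalar_of1 modulus_scalar_of normr1. Qed.

Lemma modulus_norm (a : K) : rnorm s (a : K^o) = md a.
Proof. by apply: scalar_of_inj; rewrite !scalar_of_modulus normr_id. Qed.

Section Norm.
Context (V : normedModType K).
Implicit Types v w : V.
Local Notation nm := (rnorm s).

Lemma scalar_of_rnorm v : ofR (nm v) = `|v|.
Proof. by rewrite scalar_of_modulus normr_id. Qed.

Lemma rnorm_ge0 v : 0 <= nm v.
Proof. exact: modulus_ge0. Qed.

Lemma rnormD v w : nm (v + w) <= nm v + nm w.
Proof. by rewrite -ler_scalar_of scalar_ofD !scalar_of_rnorm ler_normD. Qed.

Lemma rnormZ a v : nm (a *: v) = md a * nm v.
Proof.
rewrite /rnorm normrZ modulusM; congr (_ * _).
by apply: scalar_of_inj; rewrite !scalar_of_modulus normr_id.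
Qed.

Lemma rnorm0 : nm (0 : V) = 0.
Proof. by apply: scalar_of_inj; rewrite scalar_of_rnorm scalar_of0 normr0. Qed.

Lemma rnorm_eq0 v : nm v = 0 -> v = 0.
Proof.
by move=> v0; apply/normr0_eq0; rewrite -scalar_of_rnorm v0 scalar_of0.
Qed.

Lemma rnormN v : nm (- v) = nm v.
Proof. by rewrite /rnorm normrN. Qed.

Lemma rnorm_distC v w : nm (v - w) = nm (w - v).
Proof. by rewrite -opprB rnormN. Qed.

Lemma cvg_rnormP (T : Type) (F : set_system T) {FF : Filter F} (f : T -> V)
    (l : V) :
  f @ F --> l <-> forall e : R, 0 < e -> \forall t \near F, nm (l - f t) < e.
Proof.
split=> [/cvgrPdist_lt fl e e0|fl].
  have := fl (ofR e); rewrite scalar_of_gt0 => /(_ e0).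
  by apply: filterS => t; rewrite -scalar_of_rnorm ltr_scalar_of.
apply/cvgrPdist_lt => e /gt0_scalarP[r r0 ->]; have := fl _ r0.
by apply: filterS => t; rewrite -scalar_of_rnorm ltr_scalar_of.
Qed.

End Norm.
End Scalars.

(** * Sublinear functionals *)

Section Sublinear.
Context (R : realType) (V : lmodType R).
Implicit Types (p q : V -> R) (C : set (V * R)).

(** One inequality of homogeneity is easier to check for infima; scaling back by [t^-1] recovers
    equality in [sublinearZ]. *)
Definition sublinear q :=
  (forall x y, q (x + y) <= q x + q y) /\
  (forall t x, 0 < t -> q (t *: x) <= t * q x).

Lemma sublinear0 q : sublinear q -> q 0 = 0.
Proof.
move=> [_ qZ].
have h2 : q 0 <= 2 * q 0 by rewrite -{1}(scaler0 _ 2) qZ.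
have h3 : q 0 <= 2^-1 * q 0 by rewrite -{1}(scaler0 _ 2^-1) qZ// invr_gt0.
lra.
Qed.

Lemma sublinear_ge q x : sublinear q -> - q (- x) <= q x.
Proof.
move=> sq; have := sq.1 x (- x); rewrite subrr sublinear0//; lra.
Qed.

Lemma sublinearZ q t x : sublinear q -> 0 < t -> q (t *: x) = t * q x.
Proof.
move=> sq t0; apply/eqP; rewrite eq_le sq.2//=.
have := sq.2 t^-1 (t *: x); rewrite invr_gt0 => /(_ t0).
by rewrite scalerA mulVf ?gt_eqF// scale1r ler_pdivlMl.
Qed.

(** For a convex cone [C] with [c.2 <= q c.1] on it, this is the largest sublinear functional below
    [q] whose value at each [- c.1] is at most [- c.2]. A linear [L] below it thus satisfies
    [c.2 <= L c.1]. *)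
Definition cone_inf q C (v : V) : R := inf [set q (v + c.1) - c.2 | c in C].

Lemma cone_inf_le q C v c : sublinear q -> (forall c, C c -> c.2 <= q c.1) ->
  C c -> cone_inf q C v <= q (v + c.1) - c.2.
Proof.
move=> sq Cq Cc; apply: ge_inf; last by exists c.
(* Subadditivity gives [q d.1 <= q (v + d.1) + q (- v)], and [d.2 <= q d.1]; so the infimum is over
   a set bounded below and is not a default value. *)
exists (- q (- v)) => _ [d Cd <-].
have := sq.1 (v + d.1) (- v); rewrite addrAC subrr add0r; have := Cq _ Cd; lra.
Qed.

Lemma cone_infP q C : sublinear q -> C (0, 0) ->
  (forall c d, C c -> C d -> C (c.1 + d.1, c.2 + d.2)) ->
  (forall t c, 0 < t -> C c -> C (t *: c.1, t * c.2)) ->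
  (forall c, C c -> c.2 <= q c.1) ->
  [/\ sublinear (cone_inf q C), forall v, cone_inf q C v <= q v &
      forall c, C c -> cone_inf q C (- c.1) <= - c.2].
Proof.
move=> sq C0 CD CZ Cq.
have hle v c : C c -> cone_inf q C v <= q (v + c.1) - c.2.
  exact: cone_inf_le.
have hge v l : (forall c, C c -> l <= q (v + c.1) - c.2) -> l <= cone_inf q C v.
  move=> h; apply: lb_le_inf; first by exists (q (v + 0) - 0); exists (0, 0).
  by move=> _ [c Cc <-]; exact: h.
split.
- split=> [x y|t x t0].
    rewrite -lerBlDl; apply: (hge) => d Cd; rewrite lerBlDl -lerBlDr.
    apply: (hge) => c Cc; rewrite lerBlDr.
    apply: le_trans (hle _ _ (CD _ _ Cc Cd)) _ => /=.
    have := sq.1 (x + c.1) (y + d.1); rewrite addrACA; lra.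
  rewrite -ler_pdivrMl//; apply: (hge) => c Cc; rewrite ler_pdivrMl//.
  apply: le_trans (hle _ _ (CZ _ _ t0 Cc)) _ => /=.
  by rewrite -scalerDr mulrBr lerB// sq.2.
- by move=> v; have := hle v _ C0; rewrite /= addr0 subr0.
- by move=> c Cc; have := hle (- c.1) _ Cc; rewrite addNr sublinear0// sub0r.
Qed.

Lemma minimal_sublinear p : sublinear p ->
  exists q, [/\ sublinear q, forall v, q v <= p v &
    forall r, sublinear r -> (forall v, r v <= q v) -> r = q].
Proof.
move=> sp; pose T := {q | sublinear q /\ forall v, q v <= p v}.
(* The order is reversed: a maximal element for Zorn's lemma is a pointwise minimal functional. *)
pose Rel (a b : T) := `[< forall v, sval b v <= sval a v >].
have [||||[q [sq qp]] qmin] := @Zorn T Rel.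
- by move=> a; apply/asboolP.
- move=> a b c /asboolP ab /asboolP bc; apply/asboolP => v.
  exact: le_trans (bc v) (ab v).
- move=> [a ha] [b hb] /asboolP ab /asboolP ba; apply: eq_exist.
  by apply/funext => v; apply/eqP; rewrite eq_le ab ba.
- move=> A totA; have [[a0 Aa0]|nA] := pselect (exists a, A a); last first.
    by exists (exist _ p (conj sp (fun=> lexx _))) => a Aa; exfalso; apply: nA; exists a.
  (* The pointwise infimum bounds the chain; it is finite since every member is at least [- p (- v)]
     at [v]. *)
  pose m v := inf [set sval a v | a in A].
  have hle v a : A a -> m v <= sval a v.
    move=> Aa; apply: ge_inf; last by exists a.
    exists (- p (- v)) => _ [[b [sb bp]] Ab <-] /=.
    by apply: le_trans (sublinear_ge v sb); rewrite lerN2.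
  have hge v l : (forall a, A a -> l <= sval a v) -> l <= m v.
    move=> h; apply: lb_le_inf; first by exists (sval a0 v); exists a0.
    by move=> _ [a Aa <-]; exact: h.
  have sm : sublinear m /\ forall v, m v <= p v.
    split; last first.
      by move=> v; apply: le_trans (hle v _ Aa0) _; case: a0 {Aa0} => a0 [].
    split=> [x y|t x t0].
      rewrite -lerBlDl; apply: (hge) => a Aa; rewrite lerBlDl -lerBlDr.
      apply: (hge) => b Ab; rewrite lerBlDr.
      (* Of two members of the chain, the smaller one lies below both, and its subadditivity gives
         that of the infimum. *)
      have [ab|ab] := totA _ _ Aa Ab; move/asboolP: ab => ab.
        apply: le_trans (hle _ _ Ab) _; apply: le_trans ((svalP b).1.1 x y) _.
        by rewrite lerD.
      apply: le_trans (hle _ _ Aa) _; apply: le_trans ((svalP a).1.1 x y) _.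
      by rewrite lerD.
    rewrite -ler_pdivrMl//; apply: (hge) => a Aa; rewrite ler_pdivrMl//.
    by apply: le_trans (hle _ _ Aa) _; exact: (svalP a).1.2.
  by exists (exist _ m sm) => a Aa; apply/asboolP => v; exact: hle.
exists q; split=> // r sr rq.
have rp v : r v <= p v by apply: le_trans (rq v) (qp v).
by have /(congr1 sval) := qmin (exist _ r (conj sr rp)) (asboolT rq).
Qed.

Lemma minimal_sublinear_additive q : sublinear q ->
  (forall r, sublinear r -> (forall v, r v <= q v) -> r = q) ->
  forall x y, q (x + y) = q x + q y.
Proof.
move=> sq qmin.
(* [v |-> inf_(t >= 0) (q (v + t y) - t q y)] is sublinear and at most [q],
   hence equal to [q]; at [- y], taking [t = 1] bounds it by [- q y]. *)
have qN y : q (- y) <= - q y.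
  pose C : set (V * R) := [set c | exists2 t, 0 <= t & c = (t *: y, t * q y)].
  have [||||sC Cle CN] := @cone_infP q C sq.
  - by exists 0; rewrite ?scale0r ?mul0r.
  - move=> c d [t t0 ->] [u u0 ->]; exists (t + u); first exact: addr_ge0.
    by rewrite scalerDl mulrDl.
  - move=> t c t0 [u u0 ->]; exists (t * u); first by rewrite mulr_ge0// ltW.
    by rewrite /= scalerA mulrA.
  - move=> c [t]; rewrite le_eqVlt => /predU1P[<-|t0] -> /=.
      by rewrite scale0r mul0r sublinear0.
    by rewrite sublinearZ.
  rewrite -(qmin _ sC Cle).
  have := CN (1 *: y, 1 * q y); rewrite /= scale1r mul1r (qmin _ sC Cle); apply.
  by exists 1; rewrite ?scale1r ?mul1r.
move=> x y; apply/eqP; rewrite eq_le sq.1/=.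
have := sq.1 (- x) (- y); rewrite -opprD.
have := qN x; have := qN y; have := sublinear_ge (x + y) sq; lra.
Qed.

(** Hahn-Banach separation: finite sums of values of [h] form a convex cone on which [p] is
    nonnegative. A minimal sublinear functional below [cone_inf] of this cone, with second
    components 0, is linear and nonnegative on the cone. *)
Lemma sublinear_separation p (A : Type) (h : A -> V) : sublinear p ->
  (forall s : seq A, 0 <= p (\sum_(a <- s) h a)) ->
  (forall t a, 0 < t -> exists b, h b = t *: h a) ->
  exists L : V -> R, [/\ forall x y, L (x + y) = L x + L y,
    forall t x, 0 < t -> L (t *: x) = t * L x,
    forall v, L v <= p v & forall a, 0 <= L (h a)].
Proof.
move=> sp hp hZ.
pose C : set (V * R) := [set c | exists s : seq A, c = (\sum_(a <- s) h a, 0)].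
have [||||sC Cle CN] := @cone_infP p C sp.
- by exists [::]; rewrite big_nil.
- by move=> c d [t ->] [u ->]; exists (t ++ u); rewrite big_cat addr0.
- move=> t c t0 [u ->]; have /choice[f hf] := fun a => hZ t a t0.
  exists (map f u); rewrite big_map mulr0 scaler_sumr.
  by congr (_, _); apply: eq_bigr => a _.
- by move=> c [t ->] /=.
have [q [sq qle qmin]] := minimal_sublinear sC.
exists q; split.
- exact: minimal_sublinear_additive.
- by move=> t x t0; exact: sublinearZ.
- by move=> v; exact: le_trans (qle v) (Cle v).
- move=> a; have := sublinear_ge (- h a) sq; rewrite opprK.
  have := CN (h a, 0); rewrite /= oppr0 => CNa.
  have : cone_inf p C (- h a) <= 0 by apply: CNa; exists [:: a]; rewrite big_seq1.
  have := qle (- h a); lra.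
Qed.

End Sublinear.

(** * Compactness of the dual ball *)

Section Supnorm.
Context (R : realType) (T : Type).
Implicit Types (g : T -> R).

Lemma supnorm_le g M : 0 <= M -> (forall t, `|g t| <= M) -> supnorm g <= M.
Proof.
move=> M0 gM; have [[t _]|/set0P/negP/negPn/eqP T0] := pselect ([set: T] !=set0).
  apply: ge_sup; first by exists `|g t|; exists t.
  by move=> _ [u _ <-].
by rewrite /supnorm T0 image_set0 sup0.
Qed.

Lemma le_supnorm g M t : (forall t, `|g t| <= M) -> `|g t| <= supnorm g.
Proof.
by move=> gM; apply: ub_le_sup; [exists M => _ [u _ <-]|exists t].
Qed.

Lemma supnorm_ge0 g : 0 <= supnorm g.
Proof.
rewrite /supnorm; have [hs|/sup_out ->//] := pselect (has_sup (range (fun t => `|g t|))).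
have [_ [t _ _]] := hs.1; apply: le_trans (normr_ge0 (g t)) _.
by apply: sup_upper_bound => //; exists t.
Qed.

End Supnorm.

Section DualBall.
Context (R : realType) (K : numFieldType) (s : scalar_field R K).

Lemma scalar_of_continuous : continuous (scalar_of s : R -> K).
Proof.
move=> a; apply/(@cvg_rnormP R K s K^o) => e e0.
near=> b.
rewrite modulus_norm -scalar_ofN -scalar_ofD modulus_scalar_of.
by near: b; exact: (nbhsx_ballx a _ e0).
Unshelve. all: by end_near.
Qed.

Lemma scalar_of_pair_continuous (c : K) :
  continuous (fun ab : R * R => scalar_of s ab.1 + c * scalar_of s ab.2 : K).
Proof.
move=> [a b]; apply: cvgD.
  by apply: cvg_comp; [exact: cvg_fst|exact: scalar_of_continuous].
apply: cvgMr.
by apply: cvg_comp; [exact: cvg_snd|exact: scalar_of_continuous].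
Qed.

End DualBall.

(** In the complex case the disc lies in the continuous image of the square of side [2 r]. A compact
    superset suffices for Tychonoff's theorem, since closedness of the dual ball is proved
    separately. *)
Lemma compact_disc (R : realType) (K : numFieldType) (s : scalar_field R K) (r : R) :
  exists A : set K, compact A /\ forall a, modulus s a <= r -> A a.
Proof.
case: s => /=.
  exists `[- r, r]%classic; split; first exact: segment_compact.
  by move=> a; rewrite /= in_itv/= -ler_norml.
pose toC (ab : R * R) := scalar_of (ScalarComplex R) ab.1 +
  'i%C * scalar_of (ScalarComplex R) ab.2.
exists (toC @` (`[- r, r]%classic `*` `[- r, r]%classic)).
split.
  apply: continuous_compact; last first.
    by apply: compact_setX; exact: segment_compact.
  by apply: continuous_subspaceT; exact: scalar_of_pair_continuous.
move=> [a b] /= h.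
have r0 : 0 <= r by apply: le_trans h; exact: sqrtr_ge0.
exists (a, b) => /=.
  rewrite !in_itv/= -!ler_norml.
  by split; apply: le_trans h; rewrite -[leLHS]sqrtr_sqr ler_wsqrtr//
    ?lerDl ?lerDr sqr_ge0.
by rewrite /toC; simpc.
Qed.

Section DualBallCompact.
Context (R : realType) (K : numFieldType) (s : scalar_field R K).
Context (X : normedModType K).

Lemma dual_ballP (f : X -> K) :
  dual_ball s X f <-> scalar f /\ forall x, modulus s (f x) <= rnorm s x.
Proof.
split=> [[fl fc fn]|[fl fn]].
  have f0 : f 0 = 0.
    by have := fl (-1) 0 0; rewrite scaler0 addr0 mulN1r addNr.
  have fZ a x : f (a *: x) = a * f x by rewrite -[a *: x]addr0 fl f0 addr0.
  (* Continuity at 0 bounds [f] on the unit ball by [(d / 2)^-1]. Only then is the supremum in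
     [dual_norm] an upper bound rather than the default 0. *)
  have [d d0 fd] : exists2 d : R, 0 < d & forall x, rnorm s x < d -> modulus s (f x) < 1.
    have := fc 0; move/(@cvg_rnormP R K s K^o) => /(_ 1 ltr01).
    rewrite f0 => /nbhs_ballP[_ /(gt0_scalarP s)[d d0 ->] fd].
    exists d => // x xd; have := fd x; rewrite sub0r modulus_norm modulusN; apply.
    by rewrite -ball_normE /= sub0r normrN -(scalar_of_rnorm s) ltr_scalar_of.
  have fub x : rnorm s x <= 1 -> modulus s (f x) <= 1.
    move=> x1; apply: le_trans fn; apply: ub_le_sup; last by exists x.
    exists (d / 2)^-1 => _ [y y1 <-].
    have := fd (scalar_of s (d / 2) *: y).
    rewrite rnormZ fZ modulusM modulus_scalar_of gtr0_norm ?divr_gt0// => h.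
    rewrite -[leRHS]mulr1 ler_pdivlMl ?divr_gt0// ltW// h//.
    apply: (@le_lt_trans _ _ (d / 2)); last by rewrite ltr_pdivrMr// ltr_pMr// ltr1n.
    by rewrite ler_piMr// ltW// divr_gt0.
  split=> // x; have [/rnorm_eq0->|nx0] := eqVneq (rnorm s x) 0.
    by rewrite f0 modulus0 rnorm_ge0.
  have nx : 0 < rnorm s x by rewrite lt_neqAle eq_sym nx0 rnorm_ge0.
  have := fub (scalar_of s (rnorm s x)^-1 *: x).
  rewrite rnormZ fZ modulusM modulus_scalar_of gtr0_norm ?invr_gt0// mulVf// lexx.
  by rewrite ler_pdivrMl// mulr1 => ->.
have fB x y : f (x - y) = f x - f y.
  by rewrite -[x - y]addrC -scaleN1r fl mulN1r addrC.
split=> //.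
  move=> x; apply/(@cvg_rnormP R K s K^o) => e e0; near=> y.
  rewrite modulus_norm -fB; apply: le_lt_trans (fn _) _.
  by near: y; have := @cvg_rnormP R K s X X (nbhs x) _ id x; case=> + _; apply.
apply: ge_sup; first by exists (modulus s (f 0)); exists 0 => //=; rewrite rnorm0.
by move=> _ [x x1 <-]; exact: le_trans (fn x) x1.
Unshelve. all: by end_near.
Qed.

Lemma dual_ball_closed : closed (dual_ball s X).
Proof.
move=> l lcl; apply/dual_ballP.
have FF : Filter (nbhs (l : {ptws X -> K})) by exact: nbhs_filter.
(* Linearity involves the values at three points only, and a neighbourhood in the pointwise topology
   controls all three at once. *)
have approx (e : R) (x y z : X) : 0 < e -> exists f, [/\ dual_ball s X f,
    modulus s (l x - f x) < e, modulus s (l y - f y) < e & modulus s (l z - f z) < e].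
  move=> e0.
  have lnear w : nbhs (l : {ptws X -> K}) [set f | modulus s (l w - f w) < e].
    have lw : (fun f : {ptws X -> K} => f w) @ nbhs (l : {ptws X -> K}) --> l w.
      exact: (@proj_continuous X (fun=> K) w l).
    have := (@cvg_rnormP R K s K^o _ _ FF (fun f => f w) (l w)).1 lw e e0.
    by apply: filterS => f; rewrite modulus_norm.
  have lxyz := @filterI _ _ FF _ _ (lnear x) (@filterI _ _ FF _ _ (lnear y) (lnear z)).
  have [f [fd [fx [fy fz]]]] := lcl _ lxyz.
  by exists f.
split=> [a u v|x]; last first.
  apply/ler_addgt0Pr => e e0; have [f [/dual_ballP[_ fn] fx _ _]] := approx e x x x e0.
  rewrite -[l x](subrK (f x)) addrC; apply: le_trans (modulusD _ _ _) _.
  by rewrite lerD// ltW.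
apply/eqP; rewrite -subr_eq0; apply/eqP; apply: (@modulus_eq0 _ _ s).
apply/eqP; rewrite eq_le modulus_ge0 andbT.
have c0 : 0 < 2 + modulus s a by rewrite ltr_pwDl// modulus_ge0.
apply/ler_addgt0Pr => e e0; rewrite add0r.
(* The three approximation errors add up to [E + modulus s a * E + E = e]. *)
pose E := e / (2 + modulus s a).
have eE : e = E * (2 + modulus s a) by rewrite divfK// gt_eqF.
have E0 : 0 < E by exact: divr_gt0.
have [f [/dual_ballP[fl _] fx fu fv]] := approx _ (a *: u + v) u v E0.
have -> : l (a *: u + v) - (a * l u + l v) =
   (l (a *: u + v) - f (a *: u + v)) - (a * (l u - f u) + (l v - f v)).
  by rewrite fl; ring.
apply: le_trans (modulusD _ _ _) _; rewrite modulusN.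
have := modulusD s (a * (l u - f u)) (l v - f v); rewrite modulusM.
have := ler_wpM2l (modulus_ge0 s a) (ltW fu).
move: fx fv; rewrite eE; set ma := modulus s a => h1 h2 h3 h4.
lra.
Qed.

(** Banach-Alaoglu: a closed subset of a product of compact sets of scalars. *)
Lemma dual_ball_compact : compact [set: dual_ball s X].
Proof.
have /choice[A hA] := fun x : X => compact_disc s (rnorm s x).
have cb : compact (dual_ball s X).
  apply: (@subclosed_compact _ _ [set f : {ptws X -> K} | forall x, A x (f x)]).
  - exact: dual_ball_closed.
  - by apply: (@tychonoff X (fun=> K)) => x; case: (hA x).
  - by move=> f /dual_ballP[_ fn] x; exact: (hA x).2.
(* Compactness passes from the subset to the subtype: push the filter forward, take a cluster point
   in the ball, and pull neighbourhoods back along the inclusion. *)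
move=> F FF _.
have FdB : F [set f : dual_ball s X | dual_ball s X (set_val f)].
  by apply: (filterS _ filterT) => f _; exact: set_valP.
have [l [dl lF]] := cb (set_val @ F) _ FdB.
exists (SigSub (mem_set dl)); split=> // B C FB.
rewrite nbhsE => -[_ [[D oD <-] Dl] DC].
have FB' : F [set f : dual_ball s X | (set_val @` B) (set_val f)].
  by apply: (filterS _ FB) => f Bf; exists f.
have [_ [[f Bf <-] Df]] := lF _ D FB' (open_nbhs_nbhs (conj oD Dl)).
by exists f; split=> //; exact: DC.
Qed.

(* Needed because [supnorm] has the junk value 0 on unbounded functions. *)
Lemma CBall_bounded (g : CBall s X) : exists M, forall f, modulus s (g f) <= M.
Proof.
have cg : continuous (fun f => modulus s (g f)).
  move=> f; have FF : Filter (nbhs f) by exact: nbhs_filter.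
  apply/(@cvg_rnormP R R (ScalarReal R) R^o _ _ FF) => e e0.
  have := (@cvg_rnormP R K s K^o _ _ FF g (g f)).1 (@cts_fun _ _ g f) e e0.
  apply: (@filterS _ _ FF) => h; rewrite !modulus_norm /=.
  apply: le_lt_trans; rewrite ler_distl.
  have h1 := modulusD s (g f - g h) (g h).
  have h2 := modulusD s (g h - g f) (g f).
  rewrite subrK in h1; rewrite subrK -opprB modulusN in h2.
  by apply/andP; split; lra.
have := continuous_compact (continuous_subspaceT cg) dual_ball_compact.
move=> /compact_bounded[M [_ hM]]; exists (M + 1) => f.
have := hM (M + 1); rewrite ltrDl ltr01 => /(_ isT _ (imageT _ f)) /=.
by rewrite ger0_norm ?modulus_ge0.
Qed.

End DualBallCompact.

(** * Multilinear maps *)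

Section Hybrid.
Context (m : nat) (X : 'I_m -> Type).
Implicit Types x y : forall j, X j.

(** A path from [y] at [k = 0] to [x] at [k = m] that changes one coordinate per step, so that
    statements about multilinear maps reduce to linear slices by induction on [k]. *)
Definition hybrid x y (k : nat) : forall j, X j :=
  fun j => if (j < k)%N then x j else y j.

Lemma hybrid0 x y : hybrid x y 0 = y.
Proof. by apply: functional_extensionality_dep. Qed.

Lemma hybrid_full x y : hybrid x y m = x.
Proof. by apply: functional_extensionality_dep => j; rewrite /hybrid ltn_ord. Qed.

Lemma dfwith_hybrid x y (j : 'I_m) : eqtype.dfwith (hybrid x y j) (y j) = hybrid x y j.
Proof.
apply: functional_extensionality_dep => i; have [<-|ji] := eqVneq j i.
  by rewrite eqtype.dfwith_in /hybrid ltnn.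
by rewrite eqtype.dfwith_out.
Qed.

Lemma hybridS x y (j : 'I_m) :
  hybrid x y j.+1 = eqtype.dfwith (hybrid x y j) (x j).
Proof.
apply: functional_extensionality_dep => i; have [<-|ji] := eqVneq j i.
  by rewrite eqtype.dfwith_in /hybrid ltnSn.
rewrite eqtype.dfwith_out// /hybrid ltnS leq_eqVlt.
by case: eqP => [/esym/val_inj/eqP|//]; rewrite (negPf ji).
Qed.

Lemma dfwith_id x (j : 'I_m) : eqtype.dfwith x (x j) = x.
Proof.
apply: functional_extensionality_dep => i; have [<-|ji] := eqVneq j i.
  by rewrite eqtype.dfwith_in.
by rewrite eqtype.dfwith_out.
Qed.

End Hybrid.

(* The unused argument [mT] is what lets the linear structure be inferred. *)
Definition multilinear_slice (K : numFieldType) (m : nat)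
    (X : 'I_m -> lmodType K) (Y : lmodType K) (T : (forall j, X j) -> Y)
    (mT : multilinear T) (x : forall j, X j) (j : 'I_m) (v : X j) : Y :=
  T (eqtype.dfwith x v).

Arguments multilinear_slice {K m X Y T} mT x j v.

Section Multilinear.
Context (R : realType) (K : numFieldType) (s : scalar_field R K).
Context (m : nat) (X : 'I_m -> lmodType K) (Y : normedModType K).
Context (T : (forall j, X j) -> Y) (mT : multilinear T).

Lemma multilinear_slice_linear (x : forall j, X j) (j : 'I_m) :
  linear (multilinear_slice mT x j).
Proof. exact: mT. Qed.

HB.instance Definition _ (x : forall j, X j) (j : 'I_m) :=
  GRing.isLinear.Build K (X j) Y _ (multilinear_slice mT x j)
    (@multilinear_slice_linear x j).

Lemma multilinearZ (a : 'I_m -> K) (x : forall j, X j) :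
  T (fun j => a j *: x j) = (\prod_(j < m) a j) *: T x.
Proof.
set ax := fun j => a j *: x j.
suff h k : (k <= m)%N ->
    T (hybrid ax x k) = (\prod_(j < m | (j < k)%N) a j) *: T x.
  have := h m (leqnn m); rewrite hybrid_full => ->.
  by congr (_ *: _); apply: eq_bigl => j; rewrite ltn_ord.
elim: k => [_|k IH km]; first by rewrite hybrid0 big1 ?scale1r.
pose j := Ordinal km; rewrite (hybridS ax x j).
rewrite -[LHS]/(multilinear_slice mT (hybrid ax x j) j (a j *: x j)) linearZ/=.
rewrite /multilinear_slice (dfwith_hybrid ax x j) IH; last exact: ltnW.
rewrite scalerA [in RHS](bigD1 j)//=; congr (_ *: _); congr (_ * _); apply: eq_bigl => i.
by rewrite ltnS -val_eqE /= andbC -ltn_neqAle.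
Qed.

Lemma multilinear_eq0 (x : forall j, X j) j : x j = 0 -> T x = 0.
Proof.
move=> xj0; rewrite -(dfwith_id x j) xj0.
exact: (linear0 (multilinear_slice mT x j)).
Qed.

(** Telescoping along [hybrid]: each of the [m] differences is a slice at [x j - y j], bounded by
    [C * e] times [m - 1] factors at most [M]. Since [1 <= M], the power can be rounded up to
    [M ^+ m]. *)
Lemma multilinear_lipschitz (rho : forall j, X j -> R) (C M e : R)
    (x y : forall j, X j) : 0 <= C -> 1 <= M -> 0 <= e ->
  (forall j v, 0 <= rho j v) ->
  (forall z, rnorm s (T z) <= C * \prod_(j < m) rho j (z j)) ->
  (forall j, rho j (x j) <= M) -> (forall j, rho j (y j) <= M) ->
  (forall j, rho j (x j - y j) <= e) ->
  rnorm s (T x - T y) <= m%:R * (C * M ^+ m * e).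
Proof.
move=> C0 M1 e0 rho0 hT xM yM xy.
have M0 : 0 <= M by exact: le_trans M1.
suff h k : (k <= m)%N ->
    rnorm s (T (hybrid x y k) - T y) <= k%:R * (C * M ^+ m * e).
  by have := h m (leqnn m); rewrite hybrid_full.
elim: k => [_|k IH km]; first by rewrite hybrid0 subrr rnorm0 mul0r.
pose j := Ordinal km.
rewrite -(subrK (T (hybrid x y k)) (T (hybrid x y k.+1))) -addrA.
rewrite -natr1 mulrDl mul1r addrC.
apply: le_trans (rnormD _ _ _) _; rewrite lerD ?IH 1?ltnW//.
rewrite (hybridS x y j) -{2}(dfwith_hybrid x y j).
rewrite -[X in rnorm s X]/(multilinear_slice mT (hybrid x y j) j (x j) -
  multilinear_slice mT (hybrid x y j) j (y j)).
rewrite -linearB/=; apply: le_trans (hT _) _; rewrite -mulrA ler_wpM2l//.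
rewrite (bigD1 j)//= eqtype.dfwith_in mulrC; apply: ler_pM => //.
  exact: prodr_ge0.
apply: (@le_trans _ _ (\prod_(i < m | i != j) M)).
  apply: ler_prod => i ij; rewrite rho0 eqtype.dfwith_out 1?eq_sym//=.
  by rewrite /hybrid; case: ifP.
have -> : M ^+ m = \prod_(i < m) M by rewrite prodr_const card_ord.
by rewrite [leRHS](bigD1 j)//= ler_peMl// prodr_ge0.
Qed.



End Multilinear.

(** * Product topology and boundedness of continuous multilinear maps *)

Section ProdTopology.
Context (m : nat) (Z : 'I_m -> topologicalType).
Implicit Types z : prod_topology Z.

Lemma cvg_prod_topology (F : set_system (forall j, Z j)) {FF : Filter F} z :
  (forall j, (fun x : forall j, Z j => x j) @ F --> z j) -> F --> z.
Proof.
move=> h; apply/cvg_sup => j A [_ [[B oB <-] Bz] BA].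
apply: (filterS BA).
exact: (h j B (open_nbhs_nbhs (conj oB Bz))).
Qed.

Lemma nbhs_prod_topology z (P : forall j, set (Z j)) :
  (forall j, nbhs (z j) (P j)) ->
  nbhs z [set x : prod_topology Z | forall j, P j (x j)].
Proof.
move=> zP; have FF : Filter (nbhs z) by exact: nbhs_filter.
apply: (@filter_forall _ _ (fun j x => P j (x j)) (nbhs z) FF) => j.
exact: (@proj_continuous _ Z j z _ (zP j)).
Qed.

End ProdTopology.

Section ContinuousMultilinear.
Context (R : realType) (K : numFieldType) (s : scalar_field R K).
Context (m : nat) (X : 'I_m -> normedModType K) (Y : normedModType K).
Context (T : (forall j, X j) -> Y).

(** Since [0 < m], [T] vanishes at 0, and continuity there gives a box of radius [d] on which the
    norm of [T] is at most 1. Rescaling each coordinate to norm [d] yields the constant [d^-1 ^+ m];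
    a zero coordinate cannot be rescaled, but makes [T] vanish. *)
Lemma continuous_multilinear_bounded : (0 < m)%N -> continuous_multilinear T ->
  exists2 C : R, 0 <= C & forall x, rnorm s (T x) <= C * \prod_(j < m) rnorm s (x j).
Proof.
move=> m0 [mT cT].
have [d d0 hd] : exists2 d : R, 0 < d & forall x : forall j, X j,
    (forall j, rnorm s (x j) <= d) -> rnorm s (T x) <= 1.
  pose F := filter_from [set d : R | 0 < d]
    (fun d => [set x : forall j, X j | forall j, rnorm s (x j) <= d]).
  have FF : Filter F.
    apply: filter_from_filter; first by exists 1 => /=.
    move=> d e d0 e0; exists (Num.min d e) => /=; first by rewrite lt_min d0.
    by move=> x xde; split=> j; apply: le_trans (xde j) _; rewrite ge_min lexx ?orbT.
  have F0 : F --> ((fun=> 0) : prod_topology X).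
    apply: cvg_prod_topology => j; apply/(@cvg_rnormP R K s) => e e0.
    exists (e / 2) => /=; first by rewrite divr_gt0.
    move=> x xe; rewrite /= sub0r rnormN; apply: le_lt_trans (xe j) _.
    by rewrite ltr_pdivrMr// ltr_pMr// ltr1n.
  have T0 : T (fun=> 0) = 0 by rewrite (@multilinear_eq0 _ _ _ _ _ mT _ (Ordinal m0)).
  have /(@cvg_rnormP R K s)/(_ 1 ltr01) := cvg_trans (cvg_app T F0) (cT _).
  rewrite T0 => -[d d0 dT]; exists d => // x xd; have /= := dT x xd.
  by rewrite sub0r rnormN => /ltW.
exists (d^-1 ^+ m) => [|x]; first by rewrite exprn_ge0// invr_ge0 ltW.
have [[j xj0]|xn0] := pselect (exists j, x j = 0).
  rewrite (multilinear_eq0 mT xj0) rnorm0; apply: mulr_ge0.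
    by rewrite exprn_ge0// invr_ge0 ltW.
  by apply: prodr_ge0 => i _; exact: rnorm_ge0.
have nx j : 0 < rnorm s (x j).
  rewrite lt_neqAle rnorm_ge0 andbT eq_sym; apply/eqP => /rnorm_eq0 xj0.
  by apply: xn0; exists j.
have := hd (fun j => scalar_of s (d / rnorm s (x j)) *: x j).
rewrite multilinearZ// rnormZ (big_morph _ (modulusM s) (modulus1 s)).
under eq_bigr => j _ do rewrite modulus_scalar_of gtr0_norm ?divr_gt0//.
rewrite big_split/= prodr_const card_ord prodfV => /(_ _)/wrap[j|h].
  by rewrite rnormZ modulus_scalar_of gtr0_norm ?divr_gt0// divfK ?gt_eqF.
rewrite exprVn ler_pdivlMl ?exprn_gt0//.
by move: h; rewrite mulrAC ler_pdivrMr ?prodr_gt0// mul1r.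
Qed.

End ContinuousMultilinear.

(** * Bounded functions *)

Section BoundedFunctions.
Context (R : realType) (W : Type).

Definition bounded_funs : {pred W -> R^o} :=
  fun v => `[< exists M, forall w, `|v w| <= M >].

Lemma bounded_funs_submod : submod_closed bounded_funs.
Proof.
split; first by apply/asboolP; exists 0 => w; rewrite normr0.
move=> a u v /asboolP[M uM] /asboolP[N vN]; apply/asboolP.
exists (`|a| * M + N) => w; apply: le_trans (ler_normD _ _) _.
by rewrite lerD// normrM ler_wpM2l.
Qed.

HB.instance Definition _ :=
  GRing.isSubmodClosed.Build R (W -> R^o) bounded_funs bounded_funs_submod.

Record bounded_fun := BoundedFun {
  bounded_fun_val :> W -> R^o;
  bounded_funP : bounded_fun_val \in bounded_funs }.

HB.instance Definition _ := [isSub for bounded_fun_val].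
HB.instance Definition _ := [Choice of bounded_fun by <:].
HB.instance Definition _ := [SubChoice_isSubLmodule of bounded_fun by <:].

Lemma bounded_fun_bound (v : bounded_fun) : exists M, forall w, `|v w| <= M.
Proof. exact/asboolP/bounded_funP. Qed.

Lemma bounded_fun_sum I (r : seq I) (P : pred I) (F : I -> bounded_fun) w :
  (\sum_(i <- r | P i) F i) w = \sum_(i <- r | P i) F i w.
Proof. by elim/big_rec2 : _ => // i y1 y2 _ <-. Qed.

(** For nonempty [W], the linear functionals below it are the positive ones with value 1 at the
    constant 1, that is, the finitely additive probabilities on [W]. *)
Definition bounded_sup (v : bounded_fun) : R := sup (range v).

Lemma bounded_sup_ge (v : bounded_fun) w : v w <= bounded_sup v.
Proof.
have [M vM] := bounded_fun_bound v.
apply: ub_le_sup; last by exists w.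
by exists M => _ [u _ <-]; apply: le_trans (vM u); exact: ler_norm.
Qed.

Lemma bounded_sup_le (w0 : W) (v : bounded_fun) M :
  (forall w, v w <= M) -> bounded_sup v <= M.
Proof.
move=> vM; apply: ge_sup; first by exists (v w0); exists w0.
by move=> _ [w _ <-].
Qed.

Lemma bounded_sup_sublinear (w0 : W) : sublinear bounded_sup.
Proof.
split=> [x y|t x t0]; apply: (bounded_sup_le w0) => w.
  by rewrite lerD// bounded_sup_ge.
by rewrite ler_pM2l// bounded_sup_ge.
Qed.

End BoundedFunctions.

Lemma prod_powR (R : realType) (I : finType) (a : R) (r : I -> R) :
  (forall i, 0 <= r i) -> \prod_i a `^ r i = a `^ (\sum_i r i).
Proof.
move=> r0; suff [] : \prod_i a `^ r i = a `^ (\sum_i r i) /\ 0 <= \sum_i r i by [].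
elim/big_rec2 : _ => [|i x y _ [-> x0]]; first by rewrite powRr0.
split; last exact: addr_ge0.
(* For [a = 0] the law of exponents needs care when the exponents sum to 0; being nonnegative, both
   are then 0. *)
have [ry0|ry0] := eqVneq (r i + x) 0; last by rewrite powRD// (negPf ry0).
have [/eqP ri /eqP xx] : r i == 0 /\ x == 0.
  by apply/andP; rewrite -paddr_eq0//; apply/eqP.
by rewrite ry0 ri xx powRr0 mulr1.
Qed.

(** * Pietsch domination *)

Lemma le_powR_base (R : realType) (r x y : R) :
  0 <= r -> 0 <= x -> x <= y -> x `^ r <= y `^ r.
Proof.
by move=> r0 x0 xy; apply: ge0_ler_powR; rewrite ?nnegrE//; exact: le_trans xy.
Qed.

(** * The powers of [Phi] on a single dual ball and their supremum norm *)

Section AbstractNorm.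
Context (R : realType) (K : numFieldType) (s : scalar_field R K).
Context (X : normedModType K) (Phi : hat s X -> CBall s X) (q : R).
Implicit Types (n : nat) (f : dual_ball s X).

Definition phi_powR (x : X) f : R := modulus s (Phi (to_hat s x) f) `^ q.

Lemma phi_powR_ge0 x f : 0 <= phi_powR x f.
Proof. exact: powR_ge0. Qed.

Lemma phi_powR_bound (q0 : 0 < q) x : exists M, forall f, phi_powR x f <= M.
Proof.
have [M hM] := CBall_bounded (Phi (to_hat s x)); exists (M `^ q) => f.
by apply: le_powR_base; [exact: ltW|exact: modulus_ge0|exact: hM].
Qed.

Lemma phi_powRZ (Phi_homogeneous : homogeneous Phi) (q0 : 0 < q) (t : R) x f :
  0 < t -> phi_powR (scalar_of s t *: x) f = t `^ q * phi_powR x f.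
Proof.
move=> t0; rewrite /phi_powR.
rewrite (Phi_homogeneous (scalar_of s t) (to_hat s x)).
- by rewrite modulusM modulus_scalar_of gtr0_norm// powRM ?modulus_ge0 1?ltW.
- by rewrite scalar_of_gt0.
move=> g /=; have /dual_ballP[gl _] := set_valP g.
have g0 : \val g 0 = 0.
  by have := gl (-1) 0 0; rewrite scaler0 addr0 mulN1r addNr.
by have := gl (scalar_of s t) x 0; rewrite addr0 g0 addr0.
Qed.

Lemma abstract_norm_ge0 n (x : 'I_n -> X) : 0 <= abstract_norm Phi q x.
Proof. exact: supnorm_ge0. Qed.

Lemma abstract_norm_le n (x : 'I_n -> X) M : 0 < q -> 0 <= M ->
  (forall f, \sum_(i < n) phi_powR (x i) f <= M) ->
  abstract_norm Phi q x <= M `^ q^-1.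
Proof.
move=> q0 M0 xM; apply: supnorm_le => [|f]; first exact: powR_ge0.
rewrite ger0_norm ?powR_ge0//; apply: le_powR_base.
- by rewrite invr_ge0 ltW.
- by rewrite sumr_ge0// => i _; exact: phi_powR_ge0.
- exact: xM.
Qed.

Lemma le_abstract_norm n (x : 'I_n -> X) f : 0 < q ->
  \sum_(i < n) phi_powR (x i) f <= abstract_norm Phi q x `^ q.
Proof.
move=> q0; have sum0 g : 0 <= \sum_(i < n) phi_powR (x i) g.
  by rewrite sumr_ge0// => i _; exact: phi_powR_ge0.
(* A bound uniform over the dual ball makes the supremum in [abstract_norm] genuine rather than the
   default 0. *)
have /choice[M hM] := fun i => phi_powR_bound q0 (x i).
pose F g := (\sum_(i < n) phi_powR (x i) g) `^ q^-1.
have FM g : `|F g| <= (\sum_(i < n) M i) `^ q^-1.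
  rewrite ger0_norm ?powR_ge0//; apply: le_powR_base.
  - by rewrite invr_ge0 ltW.
  - exact: sum0.
  - by apply: ler_sum => i _; exact: hM.
have le_sup : F f <= abstract_norm Phi q x.
  have := le_supnorm f FM; rewrite ger0_norm; last exact: powR_ge0.
  exact.
rewrite -[leLHS]powRr1 ?sum0// -(mulVf (lt0r_neq0 q0)) powRrM.
by apply: le_powR_base; [exact: ltW|exact: powR_ge0|].
Qed.

End AbstractNorm.

Section Domination.
Context (R : realType) (K : numFieldType) (s : scalar_field R K).
Context (m : nat) (p : R) (q : 'I_m -> R).
Context (hp : 1 <= p) (hq : forall j, 1 <= q j).
Context (hpq : p^-1 = \sum_(j < m) (q j)^-1).
Context (X : 'I_m -> normedModType K) (Y : normedModType K).
Context (Phi : forall j, hat s (X j) -> CBall s (X j)).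
Context (Phi_homogeneous : forall j, homogeneous (@Phi j)).
Context (T : (forall j, X j) -> Y) (mT : multilinear T).

Let p0 : 0 < p. Proof. exact: lt_le_trans hp. Qed.
Let q0 j : 0 < q j. Proof. exact: lt_le_trans (hq j). Qed.

(** On the product, functions on the different dual balls become functions of one point, so a single
    functional handles every [j]. *)
Let Omega := forall j, dual_ball s (X j).

Let zero_functional (Z : normedModType K) : dual_ball s Z.
Proof.
suff h : dual_ball s Z (fun=> 0) by exact: (SigSub (mem_set h)).
by apply/dual_ballP; split=> [a u v|x]; rewrite ?mulr0 ?addr0// modulus0 rnorm_ge0.
Qed.

Let w0 : Omega := fun j => zero_functional (X j).

Lemma phi_fun_subproof j (x : X j) :
  (fun w : Omega => phi_powR (@Phi j) (q j) x (w j)) \in @bounded_funs R Omega.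
Proof.
have [M hM] := phi_powR_bound (@Phi j) (q0 j) x.
by apply/asboolP; exists M => w; rewrite ger0_norm ?phi_powR_ge0.
Qed.

Definition phi_fun j (x : X j) : bounded_fun R Omega :=
  BoundedFun (phi_fun_subproof x).

Lemma const_fun_subproof (c : R) : (fun=> c) \in @bounded_funs R Omega.
Proof. by apply/asboolP; exists `|c|. Qed.

Definition const_fun (c : R) : bounded_fun R Omega :=
  BoundedFun (const_fun_subproof c).

(** Separation is applied to [h], the difference of the two sides of the last conclusion before
    integration by [L]. The summing inequality says exactly what is needed: no finite sum of values
    of [h] has a negative supremum. *)
Lemma domination_functional (C : R) : 0 < C ->
  (forall (n : nat) (x : forall j, 'I_n -> X j),
    (\sum_(i < n) rnorm s (T (fun j => x j i)) `^ p) `^ p^-1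
      <= C * \prod_(j < m) abstract_norm (@Phi j) (q j) (x j)) ->
  exists L : bounded_fun R Omega -> R, [/\ forall x y, L (x + y) = L x + L y,
    forall t x, 0 < t -> L (t *: x) = t * L x,
    forall (v : bounded_fun R Omega) M, (forall w, v w <= M) -> L v <= M &
    forall x, rnorm s (T x) `^ p <= C `^ p * \sum_(j < m) L (phi_fun (x j))].
Proof.
move=> C0 hT.
pose h (x : forall j, X j) : bounded_fun R Omega :=
  C `^ p *: \sum_(j < m) phi_fun (x j) - const_fun (rnorm s (T x) `^ p).
have hE x w : h x w =
    C `^ p * \sum_(j < m) phi_powR (@Phi j) (q j) (x j) (w j) - rnorm s (T x) `^ p.
  by rewrite /h -(bounded_fun_sum _ _ (fun j => phi_fun (x j))).
have CC : 0 < C `^ p by rewrite powR_gt0.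
have [||L [LD LZ Lp Lh]] := sublinear_separation (h := h) (bounded_sup_sublinear R w0).
- move=> r; pose n := size r; pose x j (i : 'I_n) := tnth (in_tuple r) i j.
  set M := bounded_sup _.
  pose N := \sum_(a <- r) rnorm s (T a) `^ p.
  have N0 : 0 <= N by rewrite sumr_ge0// => i _; exact: powR_ge0.
  (* As [M] bounds the sum of the [h a], the double sum of powers is at most [D] at every point, and
     so is its part for each [j]. The product of the norms is then at most the power [p^-1] of [D],
     and the summing inequality gives [N <= M + N]. *)
  pose D := (M + N) / C `^ p.
  have sumD w : \sum_(j < m) \sum_(a <- r) phi_powR (@Phi j) (q j) (a j) (w j) <= D.
    rewrite ler_pdivlMr// mulrC -lerBlDr.
    have := bounded_sup_ge (\sum_(a <- r) h a) w; rewrite bounded_fun_sum.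
    under eq_bigr => a _ do rewrite hE.
    rewrite big_split/= sumrN -mulr_sumr exchange_big/=; exact.
  have sumDj j f : \sum_(i < n) phi_powR (@Phi j) (q j) (x j i) f <= D.
    have := sumD (eqtype.dfwith w0 f); rewrite (bigD1 j)//= eqtype.dfwith_in => h1.
    apply: le_trans h1; rewrite (big_tnth _ _ r) lerDl sumr_ge0// => i _.
    by rewrite sumr_ge0// => a _; exact: phi_powR_ge0.
  have D0 : 0 <= D.
    apply: le_trans (sumD w0); rewrite sumr_ge0// => i _.
    by rewrite sumr_ge0// => a _; exact: phi_powR_ge0.
  have := hT n x.
  have -> : \sum_(i < n) rnorm s (T (fun j => x j i)) `^ p = N.
    by rewrite /N (big_tnth _ _ r).
  have prodD : \prod_(j < m) abstract_norm (@Phi j) (q j) (x j) <= D `^ p^-1.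
    rewrite hpq -prod_powR; last by move=> j; rewrite invr_ge0 ltW.
    apply: ler_prod => j _; rewrite abstract_norm_ge0/=.
    by apply: abstract_norm_le.
  move=> /le_trans-/(_ _ (ler_wpM2l (ltW C0) prodD)) NC.
  have : N <= C `^ p * D.
    have -> : C `^ p * D = (C * D `^ p^-1) `^ p.
      rewrite powRM ?powR_ge0//; last exact: ltW.
      by rewrite -powRrM mulVf ?lt0r_neq0// powRr1.
    rewrite -[leLHS]powRr1// -(mulVf (lt0r_neq0 p0)) powRrM.
    by apply: le_powR_base; [exact: ltW|exact: powR_ge0|].
  by rewrite mulrC divfK ?gt_eqF//; lra.
(* This scaling multiplies each [phi_powR] by [t], and [T] by the power [p^-1] of [t] because the
   [(q j)^-1] sum to [p^-1]; so [h] is multiplied by [t]. *)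
- move=> t x t0; exists (fun j => scalar_of s (t `^ (q j)^-1) *: x j).
  have tq j : (t `^ (q j)^-1) `^ q j = t.
    by rewrite -powRrM mulVf ?lt0r_neq0// powRr1// ltW.
  apply: val_inj; apply/funext => w.
  rewrite [LHS]hE [RHS]/= -[X in _ = t *: X]/(h x w) hE.
  under eq_bigr => j _ do rewrite phi_powRZ ?powR_gt0// tq.
  rewrite -mulr_sumr multilinearZ// rnormZ (big_morph _ (modulusM s) (modulus1 s)).
  under eq_bigr => j _ do rewrite modulus_scalar_of ger0_norm ?powR_ge0//.
  rewrite prod_powR -?hpq; last by move=> j; rewrite invr_ge0 ltW.
  rewrite powRM ?powR_ge0 ?rnorm_ge0// -powRrM mulVf ?lt0r_neq0// powRr1 1?ltW//.
  by rewrite -[RHS]/(t * _) mulrBr mulrCA.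
have LM (v : bounded_fun R Omega) M : (forall w, v w <= M) -> L v <= M.
  by move=> vM; exact: le_trans (Lp v) (bounded_sup_le w0 vM).
exists L; split=> // x.
have L0 : L 0 = 0 by apply: (@addrI _ (L 0)); rewrite -LD !addr0.
have := Lh x; rewrite LD LZ//.
have -> : L (\sum_(j < m) phi_fun (x j)) = \sum_(j < m) L (phi_fun (x j)).
  exact: (big_morph L LD L0).
have : L (- const_fun (rnorm s (T x) `^ p)) <= - rnorm s (T x) `^ p by apply: LM.
lra.
Qed.

Lemma domination : multi_abstract_summing Phi p q T ->
  exists2 d : forall j, X j -> R,
    (forall j, (forall x, 0 <= d j x) /\
       forall n (x : 'I_n -> X j),
         (\sum_(i < n) d j (x i) `^ q j) `^ (q j)^-1 <= abstract_norm (@Phi j) (q j) x) &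
    exists2 C, 0 <= C &
      forall x, rnorm s (T x) <= C * \prod_(j < m) d j (x j).
Proof.
move=> [C C0 /(domination_functional C0)[L [LD LZ LM LT]]].
have L0 : L 0 = 0 by apply: (@addrI _ (L 0)); rewrite -LD !addr0.
have L_ge0 j x : 0 <= L (phi_fun (j := j) x).
  have : L (- phi_fun x) <= 0.
    by apply: LM => w; rewrite -[leLHS]/(- phi_fun x w) oppr_le0; exact: phi_powR_ge0.
  have : L (phi_fun x - phi_fun x) = 0 by rewrite subrr.
  rewrite LD; lra.
pose d j x := L (phi_fun (j := j) x) `^ (q j)^-1.
have dq j x : d j x `^ q j = L (phi_fun x).
  by rewrite /d -powRrM mulVf ?lt0r_neq0// powRr1.
have d0 j x : 0 <= d j x by exact: powR_ge0.
have dZ j t x : 0 < t -> d j (scalar_of s t *: x) = t * d j x.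
  move=> t0; rewrite /d.
  have -> : phi_fun (scalar_of s t *: x) = (t `^ q j) *: phi_fun x.
    by apply: val_inj; apply/funext => w; rewrite /= phi_powRZ.
  rewrite LZ ?powR_gt0// powRM ?powR_ge0// -powRrM mulfV ?lt0r_neq0//.
  by rewrite powRr1// ltW.
exists d => [j|].
  split=> // n x.
  rewrite (eq_bigr (fun i => L (phi_fun (x i)))) => [|i _]; last exact: dq.
  rewrite -(big_morph L LD L0).
  (* As [L] is additive and bounded by the supremum, the sum is integrated as a whole and compared
     with its largest value. *)
  have h : L (\sum_(i < n) phi_fun (x i)) <= abstract_norm (@Phi j) (q j) x `^ q j.
    by apply: LM => w; rewrite bounded_fun_sum; exact: le_abstract_norm.
  rewrite -[leRHS]powRr1 ?abstract_norm_ge0// -(mulfV (lt0r_neq0 (q0 j))) powRrM.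
  apply: le_powR_base => //; first by rewrite invr_ge0 ltW.
  by rewrite (big_morph L LD L0) sumr_ge0.
(* If every [d j (x j)] is at most 1, the sum in [LT] is at most [m]; this is where the factor comes
   from. *)
pose C' := C * m%:R `^ p^-1.
have C'0 : 0 <= C' by rewrite mulr_ge0 ?powR_ge0// ltW.
have unit_bound x : (forall j, d j (x j) <= 1) -> rnorm s (T x) <= C'.
  move=> dx; rewrite -[leLHS]powRr1 ?rnorm_ge0// -(mulfV (lt0r_neq0 p0)) powRrM.
  have -> : C' = (C `^ p * m%:R) `^ p^-1.
    by rewrite powRM ?powR_ge0// -powRrM mulfV ?lt0r_neq0// powRr1// ltW.
  apply: le_powR_base; [by rewrite invr_ge0 ltW|exact: powR_ge0|].
  apply: le_trans (LT x) _; rewrite ler_wpM2l ?powR_ge0//.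
  rewrite -[m in leRHS]card_ord -sumr_const; apply: ler_sum => j _.
  have <- : 1 `^ q j = 1 by rewrite powR1.
  by rewrite -dq; apply: le_powR_base => //; exact/ltW/q0.
(* Rescaling each [x j] into the unit ball of [d j] turns the additive bound [LT]
   into a multiplicative one. *)
have scaled_bound (e : 'I_m -> R) x : (forall j, 0 < e j) ->
    (forall j, d j (x j) <= e j) -> rnorm s (T x) <= C' * \prod_(j < m) e j.
  move=> e0 dx.
  have := unit_bound (fun j => scalar_of s (e j)^-1 *: x j).
  rewrite multilinearZ// rnormZ (big_morph _ (modulusM s) (modulus1 s)).
  under eq_bigr => j _ do rewrite modulus_scalar_of gtr0_norm ?invr_gt0//.
  rewrite prodfV mulrC ler_pdivrMr ?prodr_gt0//; apply => j.
  by rewrite dZ ?invr_gt0// ler_pdivrMl// mulr1.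
exists C' => // x; have [[k dk0]|dn0] := pselect (exists k, d k (x k) = 0); last first.
  apply: scaled_bound => // j; rewrite lt_neqAle d0 andbT eq_sym.
  by apply/eqP => dj0; apply: dn0; exists j.
have -> : \prod_(j < m) d j (x j) = 0 by rewrite (bigD1 k)//= dk0 mul0r.
rewrite mulr0; apply/ler_addgt0Pr => t t0; rewrite add0r.
(* Radii must be positive: the vanishing factor gets [t / (C' * M + 1)] and the others
   [d j (x j) + 1], which makes the bound at most [t]. *)
pose M := \prod_(j < m | j != k) (d j (x j) + 1).
have M0 : 0 < M by apply: prodr_gt0 => j _; rewrite ltr_wpDl.
have CM0 : 0 < C' * M + 1 by rewrite ltr_wpDl// mulr_ge0// ltW.
pose e j := if j == k then t / (C' * M + 1) else d j (x j) + 1.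
apply: le_trans (scaled_bound e x _ _) _.
- by move=> j; rewrite /e; case: ifP => _; [exact: divr_gt0|rewrite ltr_wpDl].
- move=> j; rewrite /e; case: eqP => [->|_]; last by rewrite lerDl.
  by rewrite dk0 ltW// divr_gt0.
rewrite (bigD1 k)//= (_ : e k = t / (C' * M + 1)) ?/e ?eqxx//.
rewrite (eq_bigr (fun j => d j (x j) + 1)) => [|j /negPf->//]; rewrite -/M.
have -> : C' * (t / (C' * M + 1) * M) = t * (C' * M / (C' * M + 1)) by ring.
by rewrite ler_piMr ?(ltW t0)// ler_pdivrMr// mul1r lerDl.
Qed.

End Domination.

(** * Closure of the evaluation maps *)

Section EvalClosure.
Context (R : realType) (K : numFieldType) (s : scalar_field R K).
Context (X : lmodType K) (Y : completeNormedModType K) (d : X -> R).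

Definition dominated : Type :=
  {S : {linear X -> Y} | forall x, rnorm s (S x) <= d x}.
Implicit Types S : dominated.

(** The point [x] is chosen before [S]: this is the closure of the evaluations in the supremum norm.
    Its members are bounded because an evaluation at [x] is bounded by [d x]. *)
Definition eval_limits : {pred dominated -> Y} :=
  fun g => `[< forall e, 0 < e -> exists x, forall S, rnorm s (g S - sval S x) <= e >].

Lemma eval_limits_submod : submod_closed eval_limits.
Proof.
split; first by apply/asboolP => e e0; exists 0 => S; rewrite linear0 subr0 rnorm0 ltW.
move=> a g h /asboolP gl /asboolP hl; apply/asboolP => e e0.
have c0 : 0 < modulus s a + 1 by rewrite ltr_wpDl// modulus_ge0.
pose E := e / (modulus s a + 1).
have eE : e = E * (modulus s a + 1) by rewrite divfK// gt_eqF.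
have E0 : 0 < E by exact: divr_gt0.
have [x gx] := gl _ E0; have [y hy] := hl _ E0.
exists (a *: x + y) => S; rewrite linearP.
have -> : (a *: g + h) S - (a *: sval S x + sval S y) =
    a *: (g S - sval S x) + (h S - sval S y).
  by rewrite scalerBr addrACA -opprD.
rewrite (le_trans (rnormD _ _ _))// rnormZ eE mulrDr mulr1 mulrC lerD//.
by rewrite ler_wpM2r ?modulus_ge0.
Qed.

HB.instance Definition _ :=
  GRing.isSubmodClosed.Build K (dominated -> Y) eval_limits eval_limits_submod.

Record eval_closure := EvalClosure {
  eval_closure_val :> dominated -> Y;
  eval_closureP : eval_closure_val \in eval_limits }.

HB.instance Definition _ := [isSub for eval_closure_val].
HB.instance Definition _ := [Choice of eval_closure by <:].
HB.instance Definition _ := [SubChoice_isSubLmodule of eval_closure by <:].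
Implicit Types g h : eval_closure.

Definition eval_norm g : R := supnorm (fun S => rnorm s (g S)).

Lemma eval_closure_bound g : exists M, forall S, `|rnorm s (g S)| <= M.
Proof.
have /asboolP/(_ 1 ltr01)[x gx] := eval_closureP g; exists (1 + d x) => S.
rewrite ger0_norm ?rnorm_ge0// -[g S](subrK (sval S x)).
by rewrite (le_trans (rnormD _ _ _))// lerD// (svalP S).
Qed.

Lemma le_eval_norm g S : rnorm s (g S) <= eval_norm g.
Proof.
have [M gM] := eval_closure_bound g.
by rewrite -[leLHS]ger0_norm ?rnorm_ge0//; exact: le_supnorm gM.
Qed.

Lemma eval_norm_le g M : 0 <= M -> (forall S, rnorm s (g S) <= M) -> eval_norm g <= M.
Proof. by move=> M0 gM; apply: supnorm_le => // S; rewrite ger0_norm ?rnorm_ge0. Qed.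

Lemma eval_norm_ge0 g : 0 <= eval_norm g.
Proof. exact: supnorm_ge0. Qed.

Lemma eval_normD g h : eval_norm (g + h) <= eval_norm g + eval_norm h.
Proof.
apply: eval_norm_le => [|S]; first by rewrite addr_ge0// eval_norm_ge0.
by rewrite (le_trans (rnormD _ _ _))// lerD// le_eval_norm.
Qed.

Lemma eval_normZ_le a g : eval_norm (a *: g) <= modulus s a * eval_norm g.
Proof.
apply: eval_norm_le => [|S]; first by rewrite mulr_ge0// ?modulus_ge0 ?eval_norm_ge0.
by rewrite rnormZ ler_wpM2l ?modulus_ge0// le_eval_norm.
Qed.

Lemma eval_normZ a g : eval_norm (a *: g) = modulus s a * eval_norm g.
Proof.
apply/eqP; rewrite eq_le eval_normZ_le/=.
have [->|a0] := eqVneq a 0; first by rewrite modulus0 mul0r eval_norm_ge0.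
have ma : 0 < modulus s a.
  rewrite lt_neqAle modulus_ge0 andbT eq_sym.
  by apply: contraNneq a0 => /modulus_eq0 ->.
rewrite -ler_pdivlMl//; have := eval_normZ_le a^-1 (a *: g).
rewrite scalerA mulVf// scale1r.
suff -> : modulus s a^-1 = (modulus s a)^-1 by [].
by apply: (mulIf (lt0r_neq0 ma)); rewrite -modulusM mulVf// modulus1 mulVf ?lt0r_neq0.
Qed.

Let norm g : K := scalar_of s (eval_norm g).

Let normD g h : norm (g + h) <= norm g + norm h.
Proof. by rewrite -scalar_ofD ler_scalar_of eval_normD. Qed.

Let normZ (a : K) g : norm (a *: g) = `|a| * norm g.
Proof. by rewrite /norm eval_normZ scalar_ofM scalar_of_modulus. Qed.

Let norm_eq0 g : norm g = 0 -> g = 0.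
Proof.
rewrite -(scalar_of0 s) => /scalar_of_inj g0; apply: val_inj; apply/funext => S /=.
apply: (@rnorm_eq0 _ _ s); apply/eqP; rewrite eq_le rnorm_ge0 andbT -g0.
exact: le_eval_norm.
Qed.

HB.instance Definition _ := Lmodule_isNormed.Build K eval_closure normD normZ norm_eq0.

Lemma rnorm_eval_closure g : rnorm s g = eval_norm g.
Proof. by apply: (@scalar_of_inj _ _ s); rewrite scalar_of_rnorm. Qed.

Lemma rnorm_eval_dist g h S : rnorm s (g S - h S) <= rnorm s (g - h).
Proof. by rewrite rnorm_eval_closure; exact: (le_eval_norm (g - h)). Qed.

(** Limits exist pointwise by completeness of [Y]. The Cauchy estimate is uniform in [S] and
    survives the limit, so the limit is uniformly close to some [g0], hence to an evaluation. *)
Lemma eval_closure_complete (F : set_system eval_closure) :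
  ProperFilter F -> cauchy F -> cvg F.
Proof.
move=> FF /cauchyP Fc.
have Fcauchy e : 0 < e -> exists g0, F [set g | rnorm s (g0 - g) < e].
  move=> e0; have se0 : 0 < scalar_of s e by rewrite scalar_of_gt0.
  have [g0 Fg0] := Fc _ se0.
  exists g0; apply: filterS Fg0 => g.
  by rewrite -ball_normE /= -(scalar_of_rnorm s) ltr_scalar_of.
have cvgS S : cvg ((fun g => g S) @ F).
  apply: cauchy_cvg; apply/cauchyP => _ /(gt0_scalarP s)[e e0 ->].
  have [g0 Fg0] := Fcauchy e e0; exists (g0 S).
  change (F [set g | ball (g0 S) (scalar_of s e) (g S)]).
  apply: filterS Fg0 => g /= g0g.
  rewrite -ball_normE /= -(scalar_of_rnorm s) ltr_scalar_of.
  exact: le_lt_trans (rnorm_eval_dist g0 g S) g0g.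
pose l S := lim ((fun g => g S) @ F).
have ltl e g0 S : 0 < e -> F [set g | rnorm s (g0 - g) < e] -> rnorm s (l S - g0 S) <= e.
  move=> e0 Fg0; apply/ler_addgt0Pr => t t0.
  have Fl : F [set g | rnorm s (l S - g S) < t].
    exact: (@cvg_rnormP R K s Y _ F _ (fun g => g S) (l S)).1 (cvgS S) t t0.
  have [g [/= g0g lg]] := filter_ex (filterI Fg0 Fl).
  rewrite -(subrK (g S) (l S)) -addrA addrC (le_trans (rnormD _ _ _))// lerD ?(ltW lg)//.
  by rewrite rnorm_distC; exact: le_trans (rnorm_eval_dist g0 g S) (ltW g0g).
have lP : l \in eval_limits.
  apply/asboolP => e e0; have e20 : 0 < e / 2 by exact: divr_gt0.
  have [g0 Fg0] := Fcauchy _ e20.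
  have /asboolP/(_ _ e20)[x g0x] := eval_closureP g0; exists x => S.
  rewrite -(subrK (g0 S) (l S)) -addrA (le_trans (rnormD _ _ _))//.
  by rewrite [leRHS]splitr lerD// ltl.
apply/cvg_ex; exists (EvalClosure lP); apply/(@cvg_rnormP R K s) => e e0.
have e20 : 0 < e / 2 by exact: divr_gt0.
have [g0 Fg0] := Fcauchy _ e20; apply: filterS (Fg0) => g /= g0g.
rewrite -(subrK g0 (EvalClosure lP)) -addrA (le_lt_trans (rnormD _ _ _))//.
rewrite [ltRHS]splitr ler_ltD// rnorm_eval_closure.
by apply: eval_norm_le => [|S]; [exact: ltW|exact: (ltl _ g0 S)].
Qed.

HB.instance Definition _ := Uniform_isComplete.Build eval_closure eval_closure_complete.

Lemma eval_map_subproof x : (fun S : dominated => sval S x) \in eval_limits.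
Proof. by apply/asboolP => e e0; exists x => S; rewrite subrr rnorm0 ltW. Qed.

Definition eval_map x : eval_closure := EvalClosure (eval_map_subproof x).

Lemma eval_map_linear : linear eval_map.
Proof. by move=> a x y; apply: val_inj; apply/funext => S; rewrite /= linearP. Qed.

HB.instance Definition _ :=
  GRing.isLinear.Build K X eval_closure _ eval_map eval_map_linear.

Lemma rnorm_eval_map_le x : 0 <= d x -> rnorm s (eval_map x) <= d x.
Proof.
by move=> dx; rewrite rnorm_eval_closure; apply: eval_norm_le => // S; exact: (svalP S).
Qed.

Lemma eval_map_dense g e : 0 < e -> exists x, rnorm s (g - eval_map x) <= e.
Proof.
move=> e0; have /asboolP/(_ e e0)[x gx] := eval_closureP g; exists x.
by rewrite rnorm_eval_closure; apply: eval_norm_le; [exact: ltW|].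
Qed.

(** For [0 < c] the map [c^-1 S] is one of the dominated maps over which the norm of [eval_map x] is
    a supremum; for [c = 0], [S] vanishes. *)
Lemma le_rnorm_eval_map (S : {linear X -> Y}) (c : R) x : 0 <= c ->
  (forall v, rnorm s (S v) <= c * d v) -> rnorm s (S x) <= c * rnorm s (eval_map x).
Proof.
rewrite le_eqVlt => /predU1P[<-|c0] Sd; first by have := Sd x; rewrite !mul0r.
pose S' : {linear X -> Y} := scalar_of s c^-1 \*: S.
have Sc v : rnorm s (S' v) <= d v.
  by rewrite /= rnormZ modulus_scalar_of gtr0_norm ?invr_gt0// ler_pdivrMl.
have := le_eval_norm (eval_map x) (exist _ S' Sc).
rewrite -rnorm_eval_closure /= rnormZ modulus_scalar_of gtr0_norm ?invr_gt0//.
by rewrite ler_pdivrMl.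
Qed.

End EvalClosure.

(** * Extension by continuity *)

Section Extension.
Context (R : realType) (K : numFieldType) (s : scalar_field R K).
Context (m : nat) (X : 'I_m -> lmodType K) (G : 'I_m -> normedModType K).
Context (Y : completeNormedModType K) (u : forall j, {linear X j -> G j}).
Context (u_dense : forall j (g : G j) (e : R), 0 < e ->
  exists x, rnorm s (g - u j x) <= e).
Context (T : (forall j, X j) -> Y) (mT : multilinear T).
Context (C : R) (C0 : 0 <= C).
Context (T_bound : forall x, rnorm s (T x) <= C * \prod_(j < m) rnorm s (u j (x j))).
Implicit Types (g : forall j, G j) (x : forall j, X j).

Let close g (e : R) x := forall j, rnorm s (g j - u j (x j)) <= e.

Let close_le g e e' x : e <= e' -> close g e x -> close g e' x.
Proof. by move=> ee' gx j; exact: le_trans (gx j) ee'. Qed.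

Let close_ex g e : 0 < e -> exists x, close g e x.
Proof.
move=> e0; have h j : {x | rnorm s (g j - u j x) <= e} by exact/cid/u_dense.
by exists (fun j => sval (h j)) => j; exact: svalP (h j).
Qed.

Let close_cauchy g e : 0 < e -> exists2 d, 0 < d &
  forall x y, close g d x -> close g d y -> rnorm s (T x - T y) <= e.
Proof.
(* [M] is at least 1, as [multilinear_lipschitz] requires, and bounds the norm of [u j (x j)]
   whenever it is within 1 of [g j]. *)
move=> e0; pose M := 1 + (1 + \sum_(j < m) rnorm s (g j)).
have gM j : rnorm s (g j) + 1 <= M.
  have : rnorm s (g j) <= \sum_(j < m) rnorm s (g j).
    by rewrite (bigD1 j)//= lerDl sumr_ge0// => i _; exact: rnorm_ge0.
  rewrite /M; lra.
have M1 : 1 <= M.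
  by rewrite /M lerDl addr_ge0// sumr_ge0// => j _; exact: rnorm_ge0.
pose k := m%:R * (C * M ^+ m).
have k0 : 0 <= k by rewrite !mulr_ge0// exprn_ge0// (le_trans _ M1).
(* The images of [x] and [y] are within [2 * d] of each other, so the Lipschitz bound is
   [k * (2 * d) <= e]; [k + 1] avoids division by 0, and [d <= 1] is needed for [M]. *)
pose d := Num.min 1 (e / (2 * (k + 1))).
have d0 : 0 < d by rewrite lt_min ltr01 divr_gt0// mulr_gt0// ltr_wpDl.
have uM x : close g d x -> forall j, rnorm s (u j (x j)) <= M.
  move=> gx j; apply: le_trans (gM j).
  rewrite -[u j (x j)](subrK (g j)) addrC (le_trans (rnormD _ _ _))// lerD2l.
  by rewrite rnorm_distC (le_trans (gx j))// ge_min lexx.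
exists d => // x y gx gy.
apply: (@le_trans _ _ (k * (2 * d))).
  rewrite -mulrA.
  apply: (multilinear_lipschitz mT (rho := fun j v => rnorm s (u j v))) => //.
  - by rewrite mulr_ge0// ltW.
  - by move=> j v; exact: rnorm_ge0.
  - exact: uM.
  - exact: uM.
  - move=> j; rewrite linearB -[u j (x j)](subrK (g j)) -addrA mulr_natl mulr2n.
    by rewrite (le_trans (rnormD _ _ _))// lerD// rnorm_distC.
apply: (@le_trans _ _ (k * (2 * (e / (2 * (k + 1)))))).
  by rewrite ler_wpM2l// ler_wpM2l// ge_min lexx orbT.
have -> : k * (2 * (e / (2 * (k + 1)))) = k * e / (k + 1).
  by field; rewrite gt_eqF// ltr_wpDl.
by rewrite ler_pdivrMr ?ltr_wpDl// mulrC ler_wpM2l ?lerDl// ltW.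
Qed.

(** The filter of points whose images under the [u j] approach [g]. It is proper by density and [T]
    is Cauchy along it, so the extension does not depend on a choice of approximants. *)
Let extF g : set_system (forall j, X j) :=
  filter_from [set e : R | 0 < e] (close g).

Let extF_proper g : ProperFilter (extF g).
Proof.
apply: filter_from_proper; last by move=> e e0; exact: close_ex.
apply: filter_from_filter; first by exists 1 => /=.
move=> d e d0 e0; exists (Num.min d e) => /=; first by rewrite lt_min d0.
by move=> x xde; split; apply: close_le xde; rewrite ge_min lexx ?orbT.
Qed.

Definition multilinear_extension g : Y := lim (T @ extF g).

Let extensionP g e : 0 < e -> exists2 d, 0 < d &
  forall x, close g d x -> rnorm s (multilinear_extension g - T x) <= e.
Proof.
move=> e0; have FF := extF_proper g.
have cT : cvg (T @ extF g).
  apply: cauchy_cvg; apply/cauchyP => _ /(gt0_scalarP s)[r r0 ->].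
  have r20 : 0 < r / 2 by exact: divr_gt0.
  have [d d0 dT] := close_cauchy g r20; have [x0 gx0] := close_ex g d0.
  exists (T x0), d => // x gx /=; rewrite -ball_normE /= -(scalar_of_rnorm s).
  rewrite ltr_scalar_of (le_lt_trans (dT _ _ gx0 gx))//.
  by rewrite ltr_pdivrMr// ltr_pMr// ltr1n.
have [d d0 dT] := close_cauchy g e0; exists d => // x gx.
apply/ler_addgt0Pr => t t0.
have [r /= r0 rT] := (@cvg_rnormP R K s Y _ _ _ T (multilinear_extension g)).1 cT t t0.
have dr0 : 0 < Num.min d r by rewrite lt_min d0.
have [y gy] := close_ex g dr0.
rewrite -(subrK (T y) (multilinear_extension g)) -addrA addrC.
rewrite (le_trans (rnormD _ _ _))// lerD//.
  by apply: dT => //; apply: close_le gy; rewrite ge_min lexx.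
by apply/ltW/rT; apply: close_le gy; rewrite ge_min lexx orbT.
Qed.

Lemma multilinear_extensionE x : multilinear_extension (fun j => u j (x j)) = T x.
Proof.
apply/eqP; rewrite -subr_eq0; apply/eqP; apply: (@rnorm_eq0 _ _ s).
apply/eqP; rewrite eq_le rnorm_ge0 andbT; apply/ler_addgt0Pr => e e0; rewrite add0r.
have [d d0 dT] := extensionP (fun j => u j (x j)) e0.
by apply: dT => j; rewrite subrr rnorm0 ltW.
Qed.

Lemma multilinear_extension_continuous :
  continuous (multilinear_extension : prod_topology G -> Y).
Proof.
move=> g; have FF : Filter (nbhs (g : prod_topology G)) by exact: nbhs_filter.
apply/(@cvg_rnormP R K s Y _ _ FF) => e e0.
have e30 : 0 < e / 3 by exact: divr_gt0.
have [d d0 dT] := extensionP g e30.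
have d20 : 0 < d / 2 by exact: divr_gt0.
have ng : nbhs (g : prod_topology G) [set h | forall j, rnorm s (g j - h j) < d / 2].
  apply: (@nbhs_prod_topology m G g (fun j => [set v | rnorm s (g j - v) < d / 2])) => j.
  have := @cvg_rnormP R K s (G j) (G j) (nbhs (g j)) _ id (g j).
  by case=> + _; apply.
apply: filterS ng => h gh.
have [r r0 rT] := extensionP h e30.
have dr0 : 0 < Num.min (d / 2) r by rewrite lt_min d20.
(* One [x] serves both points: it is close to [h] and, within [d / 2 + d / 2], to [g]. Both values
   of the extension are then within [e / 3] of [T x]. *)
have [x hx] := close_ex h dr0.
rewrite -(subrK (T x) (multilinear_extension g)) -addrA.
rewrite (le_lt_trans (rnormD _ _ _))//.
have h1 : rnorm s (multilinear_extension g - T x) <= e / 3.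
  apply: dT => j; rewrite -(subrK (h j) (g j)) -addrA (le_trans (rnormD _ _ _))//.
  rewrite [leRHS]splitr lerD// ?(ltW (gh j))// (le_trans (hx j))//.
  by rewrite ge_min lexx.
have h2 : rnorm s (T x - multilinear_extension h) <= e / 3.
  by rewrite rnorm_distC; apply: rT; apply: close_le hx; rewrite ge_min lexx orbT.
lra.
Qed.

Lemma multilinear_extension_multilinear : multilinear multilinear_extension.
Proof.
move=> g j a v w.
apply/eqP; rewrite -subr_eq0; apply/eqP; apply: (@rnorm_eq0 _ _ s).
apply/eqP; rewrite eq_le rnorm_ge0 andbT; apply/ler_addgt0Pr => e e0; rewrite add0r.
pose A := modulus s a; have A0 : 0 <= A by exact: modulus_ge0.
have A2 : 0 < A + 2 by rewrite ltr_wpDl.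
(* Linearity of [T] transfers to the extension with error [E + A * E + E = e]. *)
pose E := e / (A + 2); have E0 : 0 < E by exact: divr_gt0.
have eE : e = E * (A + 2) by rewrite divfK// gt_eqF.
have [d1 d10 h1] := extensionP (eqtype.dfwith g (a *: v + w)) E0.
have [d2 d20 h2] := extensionP (eqtype.dfwith g v) E0.
have [d3 d30 h3] := extensionP (eqtype.dfwith g w) E0.
pose d := Num.min d1 (Num.min d2 d3).
have d0 : 0 < d by rewrite !lt_min d10 d20.
have A1 : 0 < A + 1 by rewrite ltr_wpDl.
(* If [xv] and [xw] approximate [v] and [w] within [r], then [a *: xv + xw] approximates
   [a *: v + w] within [A * r + r = d]. *)
pose r := d / (A + 1); have r0 : 0 < r by exact: divr_gt0.
have rd : r * (A + 1) = d by rewrite divfK// gt_eqF.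
have rled : r <= d by rewrite -rd ler_peMr ?lerDr// ltW.
have [x gx] := close_ex g r0.
have [xv vx] := u_dense v r0; have [xw wx] := u_dense w r0.
have dfw z xz : rnorm s (z - u j xz) <= d ->
    close (eqtype.dfwith g z) d (eqtype.dfwith x xz).
  move=> zx i; have [<-|ji] := eqVneq j i; first by rewrite !eqtype.dfwith_in.
  by rewrite !eqtype.dfwith_out//; exact: le_trans (gx i) rled.
have {}h1 : rnorm s (multilinear_extension (eqtype.dfwith g (a *: v + w)) -
    T (eqtype.dfwith x (a *: xv + xw))) <= E.
  apply: h1; apply: close_le (dfw _ _ _); first by rewrite ge_min lexx.
  rewrite linearP.
  have -> : a *: v + w - (a *: u j xv + u j xw) = a *: (v - u j xv) + (w - u j xw).
    by rewrite scalerBr addrACA -opprD.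
  rewrite (le_trans (rnormD _ _ _))// rnormZ -rd mulrDr mulr1 [r * _]mulrC lerD//.
  by rewrite ler_wpM2l.
have {}h2 : rnorm s (multilinear_extension (eqtype.dfwith g v) -
    T (eqtype.dfwith x xv)) <= E.
  apply: h2; apply: close_le (dfw _ _ (le_trans vx rled)).
  by rewrite /d !ge_min lexx orbT.
have {}h3 : rnorm s (multilinear_extension (eqtype.dfwith g w) -
    T (eqtype.dfwith x xw)) <= E.
  apply: h3; apply: close_le (dfw _ _ (le_trans wx rled)).
  by rewrite /d !ge_min lexx !orbT.
move: h1 h2 h3; rewrite (mT x a).
set U := multilinear_extension _; set V := multilinear_extension _.
set W := multilinear_extension _; set t1 := T _; set t2 := T _ => h1 h2 h3.
have -> : U - (a *: V + W) =
    (U - (a *: t1 + t2)) + (- (a *: (V - t1)) + - (W - t2)).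
  by rewrite scalerBr !opprB [X in _ = _ + X]addrACA -opprD addrA subrK.
rewrite (le_trans (rnormD _ _ _))//.
have := rnormD s (- (a *: (V - t1))) (- (W - t2)); rewrite !rnormN rnormZ.
have := ler_wpM2l A0 h2; rewrite -/A; lra.
Qed.

End Extension.

(** * Factorization *)

Section Holder.
Context (R : realType).

Lemma prod_powRl (I : finType) (F : I -> R) (r : R) : (forall i, 0 <= F i) ->
  (\prod_i F i) `^ r = \prod_i F i `^ r.
Proof.
move=> F0; suff [] : (\prod_i F i) `^ r = \prod_i F i `^ r /\ 0 <= \prod_i F i by [].
elim/big_rec2 : _ => [|i x y _ [<- x0]]; first by rewrite powR1.
by rewrite powRM//; split=> //; exact: mulr_ge0.
Qed.

(** Each [t i] is at most the whole sum, and the weights add up to 1. *)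
Lemma prod_powR_le_sum (I : finType) (t w : I -> R) :
  (forall i, 0 <= t i) -> (forall i, 0 <= w i) -> \sum_i w i = 1 ->
  \prod_i t i `^ w i <= \sum_i t i.
Proof.
move=> t0 w0 w1; have M0 : 0 <= \sum_i t i by exact: sumr_ge0.
have -> : \sum_i t i = \prod_i (\sum_i t i) `^ w i by rewrite prod_powR// w1 powRr1.
apply: ler_prod => i _; rewrite powR_ge0/= le_powR_base//.
by rewrite (bigD1 i)//= lerDl sumr_ge0.
Qed.

(* Hoelder's inequality up to the constant [m ^ p^-1]: after normalization it is
   enough to bound a weighted geometric mean by the sum of its terms. *)
Lemma sum_prod_powR_le (m n : nat) (p : R) (q : 'I_m -> R) (a : 'I_m -> 'I_n -> R) :
  0 < p -> (forall j, 0 < q j) -> p^-1 = \sum_(j < m) (q j)^-1 ->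
  (forall j i, 0 <= a j i) ->
  (\sum_(i < n) (\prod_(j < m) a j i) `^ p) `^ p^-1 <=
  m%:R `^ p^-1 * \prod_(j < m) (\sum_(i < n) a j i `^ q j) `^ (q j)^-1.
Proof.
move=> p0 q0 hpq a0.
pose S j := \sum_(i < n) a j i `^ q j.
have S0 j : 0 <= S j by rewrite sumr_ge0// => i _; exact: powR_ge0.
(* Normalization divides by [S j]; if some [S k] is 0, all [a k i] vanish and so does the left
   side. *)
have [[k Sk]|Sn0] := pselect (exists k, S k = 0).
  have ak i : a k i = 0.
    have : a k i `^ q k = 0.
      have /eqP := Sk; rewrite psumr_eq0 => [/allP/(_ i)|i' _]; last exact: powR_ge0.
      by rewrite mem_index_enum => /(_ isT)/eqP.
    exact: powR_eq0_eq0.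
  rewrite big1 ?powR0 ?invr_neq0 ?lt0r_neq0//.
    by rewrite mulr_ge0 ?powR_ge0// prodr_ge0// => j _; exact: powR_ge0.
  by move=> i _; rewrite (bigD1 k)//= ak mul0r powR0 ?lt0r_neq0.
have Sp j : 0 < S j.
  by rewrite lt_neqAle S0 andbT eq_sym; apply/eqP => Sj; apply: Sn0; exists j.
have sum_le : \sum_(i < n) (\prod_(j < m) a j i) `^ p <=
    m%:R * (\prod_(j < m) S j `^ (q j)^-1) `^ p.
  (* The weights are [p / q j]. For each [j] the normalized terms add up to 1 over [i], so summing
     over [i] produces the factor [m]. *)
  have term i : (\prod_(j < m) a j i) `^ p <=
      (\sum_(j < m) a j i `^ q j / S j) * (\prod_(j < m) S j `^ (q j)^-1) `^ p.
    have b0 j : 0 <= a j i `^ q j / S j by rewrite divr_ge0// powR_ge0.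
    have w0 j : 0 <= p / q j by rewrite divr_ge0 ?ltW.
    have w1 : \sum_(j < m) p / q j = 1 by rewrite -mulr_sumr -hpq mulfV ?lt0r_neq0.
    have h := prod_powR_le_sum b0 w0 w1.
    rewrite [X in X `^ p <= _](_ : _ = (\prod_(j < m) (a j i `^ q j / S j) `^ (q j)^-1) *
      \prod_(j < m) S j `^ (q j)^-1); last first.
      rewrite -big_split/=; apply: eq_bigr => j _.
      by rewrite -powRM// divfK ?gt_eqF// -powRrM mulfV ?lt0r_neq0// powRr1.
    rewrite powRM; last 2 first.
    - by apply: prodr_ge0 => j _; exact: powR_ge0.
    - by apply: prodr_ge0 => j _; exact: powR_ge0.
    rewrite ler_wpM2r ?powR_ge0//; apply: le_trans h.
    rewrite prod_powRl; last by move=> j; exact: powR_ge0.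
    by under eq_bigr => j _ do rewrite -powRrM [_^-1 * p]mulrC.
  apply: le_trans (ler_sum _ (fun i _ => term i)) _.
  rewrite -mulr_suml exchange_big/= ler_wpM2r ?powR_ge0//.
  rewrite (eq_bigr (fun=> 1)) ?sumr_const ?card_ord// => j _.
  by rewrite -mulr_suml -/(S j) divff ?gt_eqF.
have -> : m%:R `^ p^-1 * \prod_(j < m) S j `^ (q j)^-1 =
    (m%:R * (\prod_(j < m) S j `^ (q j)^-1) `^ p) `^ p^-1.
  have P0 : 0 <= \prod_(j < m) S j `^ (q j)^-1.
    by apply: prodr_ge0 => j _; exact: powR_ge0.
  by rewrite powRM ?powR_ge0// -powRrM mulfV ?lt0r_neq0// powRr1.
apply: le_powR_base => //; first by rewrite invr_ge0 ltW.
by rewrite sumr_ge0// => i _; exact: powR_ge0.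
Qed.

End Holder.

Lemma bound_by_eval_maps (R : realType) (K : numFieldType) (s : scalar_field R K)
    (m : nat) (X : 'I_m -> lmodType K) (Y : completeNormedModType K)
    (d : forall j, X j -> R) (C : R) (T : (forall j, X j) -> Y) :
  multilinear T -> 0 <= C -> (forall j v, 0 <= d j v) ->
  (forall x, rnorm s (T x) <= C * \prod_(j < m) d j (x j)) ->
  forall x, rnorm s (T x) <= C * \prod_(j < m) rnorm s (eval_map s Y (d j) (x j)).
Proof.
move=> mT C0 d0 Td.
(* In [f k] the first [k] factors are already replaced. At the next one, the slice of [T] is bounded
   by [c * d j], where [c] collects [C] and all other factors. *)
pose f (k : nat) (j : 'I_m) (v : X j) :=
  if (j < k)%N then rnorm s (eval_map s Y (d j) v) else d j v.
suff h k : (k <= m)%N -> forall x, rnorm s (T x) <= C * \prod_(j < m) f k j (x j).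
  move=> x; apply: le_trans (h m (leqnn m) x) _.
  by under eq_bigr => j _ do rewrite /f ltn_ord.
elim: k => [_ x|k IH km x]; first exact: Td.
pose j := Ordinal km; pose c := C * \prod_(i < m | i != j) f k i (x i).
have c0 : 0 <= c.
  rewrite mulr_ge0// prodr_ge0// => i _; rewrite /f; case: ifP => // _.
  exact: rnorm_ge0.
pose S : {linear X j -> Y} := multilinear_slice mT x j.
have Sd v : rnorm s (S v) <= c * d j v.
  apply: le_trans (IH (ltnW km) _) _; rewrite (bigD1 j)//= eqtype.dfwith_in.
  rewrite {1}/f ltnn mulrCA mulrC ler_wpM2r//.
  rewrite /c (eq_bigr (fun i => f k i (x i)))// => i ij.
  by rewrite eqtype.dfwith_out// eq_sym.
have := le_rnorm_eval_map (x j) c0 Sd.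
rewrite {1}/S /= /multilinear_slice dfwith_id => /le_trans; apply.
rewrite (bigD1 j)//= {1}/f ltnSn mulrCA mulrC /c ler_wpM2l ?rnorm_ge0//.
rewrite [X in C * X <= _](eq_bigr (fun i => f k.+1 i (x i)))// => i ij.
by rewrite /f ltnS [(i <= k)%N]leq_eqVlt; move: ij; rewrite -val_eqE /= => /negPf ->.
Qed.

Theorem theorem3p7 (R : realType) (K : numFieldType) (s : scalar_field R K)
    (m : nat) (p : R) (q : 'I_m -> R)
    (hp : 1 <= p) (hq : forall j : 'I_m, 1 <= q j)
    (hpq : p^-1 = \sum_(j < m) (q j)^-1)
    (X : 'I_m -> completeNormedModType K) (Y : completeNormedModType K)
    (Phi : forall j : 'I_m, hat s (X j) -> CBall s (X j))
    (Phi_bounded : forall j : 'I_m, bounded_map (Phi j))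
    (Phi_homogeneous : forall j : 'I_m, homogeneous (Phi j))
    (T : (forall j : 'I_m, X j) -> Y) (hT : continuous_multilinear T) :
  multi_abstract_summing Phi p q T <->
  exists (G : 'I_m -> completeNormedModType K)
         (u : forall j : 'I_m, {linear X j -> G j})
         (That : (forall j : 'I_m, G j) -> Y),
    [/\ forall j : 'I_m, abstract_summing (Phi j) (q j) (u j),
        continuous_multilinear That &
        forall x : forall j : 'I_m, X j, T x = That (fun j => u j (x j))].
Proof.
have p0 : 0 < p by exact: lt_le_trans hp.
have q0 j : 0 < q j by exact: lt_le_trans (hq j).
have [mT _] := hT; split=> [sT|[G [u [That [us cThat TE]]]]].
  have [d hd [C C0 Td]] := domination hp hq hpq Phi_homogeneous mT sT.
  have d0 j x : 0 <= d j x by have [] := hd j.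
  pose u j : {linear X j -> eval_closure s Y (d j)} := eval_map s Y (d j).
  have u_dense j (g : eval_closure s Y (d j)) e : 0 < e ->
      exists x, rnorm s (g - u j x) <= e.
    exact: eval_map_dense.
  have Tu := bound_by_eval_maps mT C0 d0 Td.
  exists (fun j => eval_closure s Y (d j)), u, (multilinear_extension s u T); split.
  - move=> j; exists 1 => // n x; rewrite mul1r.
    apply: le_trans ((hd j).2 n x); apply: le_powR_base.
    + by rewrite invr_ge0 ltW.
    + by rewrite sumr_ge0// => i _; exact: powR_ge0.
    + apply: ler_sum => i _; apply: le_powR_base; [exact: ltW|exact: rnorm_ge0|].
      exact: rnorm_eval_map_le.
  - split; first exact: (multilinear_extension_multilinear u_dense mT C0 Tu).
    exact: (multilinear_extension_continuous u_dense mT C0 Tu).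
  - by move=> x; rewrite (multilinear_extensionE u_dense mT C0 Tu).
(* For [m = 0] the empty sum would force [p^-1 = 0]. *)
have m0 : (0 < m)%N.
  rewrite lt0n; apply/eqP => m0; move: hpq; rewrite big1 => [/eqP|j _].
    by rewrite invr_eq0 gt_eqF.
  by have := ltn_ord j; rewrite {2}m0.
have [B B0 hB] := continuous_multilinear_bounded s m0 cThat.
have /choice[c hc] : forall j, exists c, 0 < c /\ forall n (x : 'I_n -> X j),
    (\sum_(i < n) rnorm s (u j (x i)) `^ q j) `^ (q j)^-1 <=
      c * abstract_norm (Phi j) (q j) x.
  by move=> j; have [c c0 hc] := us j; exists c.
(* [B] bounds [That], the power of [m] comes from the Hölder inequality, and the [c j] are the
   summing constants of the [u j]. *)
pose D := B * m%:R `^ p^-1 * \prod_(j < m) c j.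
have D0 : 0 <= D.
  by rewrite !mulr_ge0 ?powR_ge0// prodr_ge0// => j _; have [/ltW] := hc j.
(* [D] may be 0, whereas the summing constant must be positive. *)
exists (D + 1) => [|n x]; first by rewrite ltr_wpDl.
have N0 : 0 <= \prod_(j < m) abstract_norm (Phi j) (q j) (x j).
  by rewrite prodr_ge0// => j _; exact: abstract_norm_ge0.
apply: (@le_trans _ _ (D * \prod_(j < m) abstract_norm (Phi j) (q j) (x j))); last first.
  by rewrite ler_wpM2r// lerDl.
pose a j i := rnorm s (u j (x j i)).
have a0 j i : 0 <= a j i by exact: rnorm_ge0.
apply: (@le_trans _ _ (B * (\sum_(i < n) (\prod_(j < m) a j i) `^ p) `^ p^-1)).
  have -> : B * (\sum_(i < n) (\prod_(j < m) a j i) `^ p) `^ p^-1 =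
      (\sum_(i < n) (B * \prod_(j < m) a j i) `^ p) `^ p^-1.
    under [in RHS]eq_bigr => i _ do rewrite powRM ?prodr_ge0//.
    rewrite -mulr_sumr powRM ?powR_ge0 ?sumr_ge0//; last by move=> i _; exact: powR_ge0.
    by rewrite -powRrM mulfV ?lt0r_neq0// powRr1.
  apply: le_powR_base.
  - by rewrite invr_ge0 ltW.
  - by rewrite sumr_ge0// => i _; exact: powR_ge0.
  - apply: ler_sum => i _; apply: le_powR_base; [exact: ltW|exact: rnorm_ge0|].
    by rewrite TE; exact: hB.
rewrite /D -2!mulrA ler_wpM2l//; apply: le_trans (sum_prod_powR_le p0 q0 hpq a0) _.
rewrite ler_wpM2l ?powR_ge0// -big_split/=; apply: ler_prod => j _.
by rewrite powR_ge0/=; have [_] := hc j; exact.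
Qed.
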